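(* As $n\to\infty$, $$\kappa_n\sim \kappa_{n,n+1}\sim\frac{2^{n(n+1)}}{(n+1)!}\sim\binom{2^n-1}{n+1}.$$ In particular, a uniformly random $(n+1)$-element subcollection of the normal vectors of the resonance arrangement $\mathcal{A}_n$ is a circuit with probability tending to $1$ as $n\to\infty$.
   Context: The resonance arrangement is $\mathcal{A}_n:=\{H_S:\varnothing\ne S\subseteq[n]\}$ with $H_S:=\{x\in\mathbb{R}^n:\sum_{j\in S}x_j=0\}$; the hyperplane $H_S$ is associated with its normal vector $\mathbf{1}_S$ (the characteristic vector of $S$), so the normals are precisely the $2^n-1$ nonzero vectors of $\{0,1\}^n$. A circuit of $\mathcal{A}_n$ is an inclusion-minimal linearly dependent (over $\mathbb{R}$) set of these normal vectors. $\kappa_{n,m}$ is the number of $m$-element circuits of $\mathcal{A}_n$, and $\kappa_n$ is the total number of circuits of $\mathcal{A}_n$. The notation $a_n\sim b_n$ means $a_n/b_n\to1$. *)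

(* Defs.v *)
(* classical_sets comes first so that finset names such as set0 take precedence. *)
From mathcomp Require Import classical_sets.
From mathcomp Require Import all_boot all_order all_algebra.
From mathcomp Require Import reals topology normedtype sequences.

Set Implicit Arguments.
Unset Strict Implicit.
Unset Printing Implicit Defensive.

Import GRing.Theory Num.Theory numFieldNormedType.Exports.
Local Open Scope ring_scope.

(* The normal vector 1_S of the hyperplane H_S = {x | \sum_(j in S) x_j = 0}. *)
Definition charvec (R : realType) (n : nat) (S : {set 'I_n}) : 'rV[R]_n :=
  \row_j (j \in S)%:R.

(* Since S |-> 1_S is injective, a set of normal vectors of the resonance
   arrangement is encoded by the set of its indices S, which must be nonempty. *)
Lemma charvec_inj (R : realType) (n : nat) : injective (@charvec R n).
Proof.
move=> S T /rowP eqST; apply/setP=> j; have := eqST j; rewrite !mxE => /eqP.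
by rewrite eqr_nat; case: (j \in S); case: (j \in T).
Qed.

Definition normals (n : nat) : {set {set 'I_n}} :=
  [set S : {set 'I_n} | S != set0].

Definition lin_dependent (R : realType) (n : nat) (C : {set {set 'I_n}}) : bool :=
  ~~ free [seq charvec R A | A <- enum C].

Definition circuit (R : realType) (n : nat) (C : {set {set 'I_n}}) : bool :=
  minset (fun D : {set {set 'I_n}} =>
            (D \subset normals n) && lin_dependent R D) C.

Definition kappa_size (R : realType) (n m : nat) : nat :=
  #|[set C : {set {set 'I_n}} | circuit R C & #|C| == m]|.

Definition kappa (R : realType) (n : nat) : nat :=
  #|[set C : {set {set 'I_n}} | circuit R C]|.

Definition asymp_equiv (R : realType) (a b : nat -> R) : Prop :=
  ((fun n => a n / b n) @ \oo --> (1 : R))%classic.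

(* Probability that a uniformly random element of the finite set A satisfies E
   (with the junk value 0 when A is empty). *)
Definition unif_prob (R : realType) (T : finType) (A : {set T}) (E : pred T) : R :=
  #|[set x in A | E x]|%:R / #|A|%:R.

Definition subcollections (n m : nat) : {set {set {set 'I_n}}} :=
  [set C : {set {set 'I_n}} | C \subset normals n & #|C| == m].

(* Main.v *)
(* The heart of the matter is that a uniformly random n x n matrix with entries
   in {0, 1} is singular with probability o(1 / n): by a union bound over the
   omitted vector, almost every (n+1)-set of normals then has only independent
   n-subsets, i.e. is a circuit, while circuits with at most n elements are
   negligible because there are few sets of that size.

   Fix g and a prime p with g n < p <= 10 g n. A singular 0/1 matrix is singular
   modulo p, hence has at least p - 1 nonzero kernel vectors over F_p, and it
   suffices to bound the sum over v != 0 of rho(v)^n by a constant independent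
   of g, where rho(v) is the proportion of sets S with sum_(j in S) v_j = 0 in
   F_p. By Fourier inversion p rho(v) <= 1 + F(v), where F(v) sums
   exp (- q(t) / 2) over t != 0 and q(t) = sum_j sin^2 (pi t v_j / p).
   - If F(v) <= 1/n, then rho(v)^n <= e / p^n.
   - Otherwise some q(t) is small, and summing exp (- c q(t)) over all v
     factorizes over coordinates, which shows that such v are rare; this settles
     F(v) <= 1.
   - If F(v) > 1, Halasz' argument bounds F(v): the level sets of q satisfy
     k T(m) <= T(k^2 m), so Cauchy-Davenport limits their sizes. The bound gains
     a small constant when no value is taken by v too often; a v taking one
     value on a positive proportion of the coordinates is rare.
   - Very sparse v are handled by rho(v) <= 1/2. *)
Require Import Defs.
From mathcomp Require Import boolp classical_sets.
From mathcomp Require Import all_boot all_order all_algebra.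
From mathcomp Require Import complex.
From mathcomp Require Import reals topology normedtype sequences exp.
From mathcomp Require Import zify ring lra.

Set Implicit Arguments.
Unset Strict Implicit.
Unset Printing Implicit Defensive.

(** * Primes between N and 10 N *)

Lemma expn2_le_bin m : 2 ^ m <= 'C(m.*2, m).
Proof.
elim: m => // m IH; rewrite doubleS binS expnS mul2n -addnn.
apply: leq_add; apply: leq_trans IH _; first by rewrite binS leq_addl.
by case: m => // m; rewrite (binS (m.+1).*2 m) leq_addr.
Qed.

Lemma bin_le_expn2 n m : 'C(n, m) <= 2 ^ n.
Proof.
elim: n m => [|n IH] [|m] //; first by rewrite bin0 expn_gt0.
by rewrite binS expnS mul2n -addnn leq_add.
Qed.

(** The prime occurs in the factorial of [n + m] but in neither of the two smaller factorials. *)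
Lemma prime_dvd_bin p n m : prime p -> n < p -> m < p -> p <= n + m ->
  p %| 'C(n + m, n).
Proof.
move=> pr np mp pnm; have bf := bin_fact (leq_addr m n).
rewrite addKn in bf.
have: p %| (n + m)`! by apply: dvdn_fact; rewrite prime_gt0.
have small k : k < p -> p %| k`! = false.
  move=> kp; apply/negbTE; rewrite fact_prod Euclid_dvd_prod // big_has_cond.
  apply/hasPn => i; rewrite mem_index_iota => /andP[i0 ik] /=.
  by apply/negP => /(dvdn_leq i0); lia.
by rewrite -bf !Euclid_dvdM // !small // !orbF.
Qed.

Lemma prod_primes_dvdn (r : seq nat) n : uniq r -> all prime r ->
  all (fun p => p %| n) r -> \prod_(p <- r) p %| n.
Proof.
elim: r => [|p r IH] /=; first by rewrite big_nil dvd1n.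
case/andP=> pr ur /andP[pp ar] /andP[pn an]; rewrite big_cons.
rewrite Gauss_dvd ?pn ?IH // prime_coprime // Euclid_dvd_prod // big_has.
apply/hasPn => q qr; have qp := allP ar q qr.
by rewrite dvdn_prime2 //; apply: contraNneq pr => ->.
Qed.

Definition primorial N := \prod_(0 <= p < N.+1 | prime p) p.

(** All primes in [(m, 2m]] divide the central binomial coefficient, which is at most [4 ^ m]. *)
Lemma primorial_double m : primorial m.*2 <= primorial m * 4 ^ m.
Proof.
rewrite /primorial (big_cat_nat _ (n := m.+1)) //=; last by lia.
rewrite leq_mul2l; apply/orP; right.
rewrite -big_filter; apply: (@leq_trans 'C(m + m, m)); last first.
  by rewrite addnn (leq_trans (bin_le_expn2 _ _)) // -mul2n expnM.
apply: dvdn_leq; first by rewrite bin_gt0 leq_addr.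
apply: prod_primes_dvdn; first by rewrite filter_uniq ?iota_uniq.
  exact: filter_all.
apply/allP => p; rewrite mem_filter mem_index_iota => /and3P[pp p1 p2].
by apply: prime_dvd_bin => //; lia.
Qed.

(** Strong induction through half of [N], rounded up to [m]. Base 16 leaves room for the rounding:
    [16 ^ m * 4 ^ m <= 16 ^ N] needs only [3 * m <= 2 * N], which holds from [N = 3] on. *)
Lemma primorial_le N : primorial N <= 16 ^ N.
Proof.
elim/ltn_ind: N => N IH; case: (leqP N 2) => [|N2].
  by rewrite /primorial; case: N {IH} => [|[|[|]]] // _; rewrite unlock.
set m := N.+1./2; have mN : m < N by rewrite /m; lia.
have Nm : N <= m.*2 by rewrite /m; lia.
apply: (@leq_trans (primorial m.*2)).
  rewrite {2}/primorial (big_cat_nat _ (n := N.+1)) //= -[leqLHS]muln1.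
  by rewrite leq_mul2l prodn_cond_gt0 ?orbT // => i /prime_gt0.
apply: leq_trans (primorial_double _) _.
apply: leq_trans (leq_mul (IH _ mN) (leqnn _)) _.
rewrite (_ : 16 = 4 ^ 2) // -!expnM -expnD leq_exp2l //; rewrite /m in mN *; lia.
Qed.

(** By Legendre's formula the exponent is the sum over [k] of [2m %/ p ^ k - 2 * (m %/ p ^ k)]. Each
    term is 0 or 1, and it vanishes once [p ^ k > 2m]. *)
Lemma logn_central_bin p m : prime p -> 0 < m ->
  logn p 'C(m.*2, m) <= trunc_log p m.*2.
Proof.
move=> pp m0; have p1 := prime_gt1 pp.
have mm : m <= m.*2 by rewrite -addnn leq_addr.
have := congr1 (logn p) (bin_fact mm); rewrite -addnn addnK addnn.
rewrite lognM ?bin_gt0 // ?muln_gt0 ?fact_gt0 // lognM ?fact_gt0 // !logn_fact //.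
have -> : \sum_(1 <= k < m.+1) m %/ p ^ k = \sum_(1 <= k < (m.*2).+1) m %/ p ^ k.
  rewrite (big_cat_nat _ (n := m.+1) (p := (m.*2).+1)) //=.
  rewrite [X in _ = _ + X]big1_seq ?addn0 // => k.
  rewrite mem_index_iota => /andP[_ /andP[mk _]]; apply: divn_small.
  by apply: leq_trans mk _; apply/ltnW/ltn_expl.
set A := \sum_(_ <= _ < _) m %/ _; set B := \sum_(_ <= _ < _) _ => E.
suff : B <= A + A + trunc_log p m.*2 by lia.
have tl : trunc_log p m.*2 <= m.*2.
  rewrite leqNgt; apply/negP => /ltnW H; have := trunc_logP p1 (_ : 0 < m.*2).
  rewrite double_gt0 => /(_ m0); rewrite leqNgt => /negP; apply.
  by apply: leq_ltn_trans H (ltn_expl _ p1).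
have -> : trunc_log p m.*2 = \sum_(1 <= k < (m.*2).+1) (k <= trunc_log p m.*2).
  rewrite (big_cat_nat _ (n := (trunc_log p m.*2).+1)) //=.
  rewrite [X in _ = _ + X]big1_seq ?addn0 => [|k]; last first.
    by rewrite mem_index_iota => /andP[_ /andP[mk _]]; rewrite leqNgt mk.
  rewrite big_nat_cond (eq_bigr (fun=> 1)) => [|k]; last by case/andP=> /andP[_]; rewrite ltnS => ->.
  by rewrite -big_nat_cond sum_nat_const_nat muln1 subn1.
rewrite /A -!big_split /= /B; apply: leq_sum => k _.
have pk : 0 < p ^ k by rewrite expn_gt0 (ltnW p1).
case: (leqP k (trunc_log p m.*2)) => H; last first.
  rewrite divn_small //; rewrite ltnNge; apply/negP => H'.
  by have := trunc_log_max p1 H'; lia.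
have := edivnD m m pk; rewrite edivn_def addnn => -[-> _].
by rewrite leq_add2l leq_b1.
Qed.

(** Erdős' estimate: only primes up to [N] can divide the coefficient. Those up to [r] contribute a
    prime power of at most [2m] each; those above [r] occur at most once, because [p ^ 2 > 2m], and
    are absorbed by the primorial. *)
Lemma central_bin_le N m r : 0 < m -> N <= m.*2 -> m.*2 < r.+1 ^ 2 ->
  (forall p, prime p -> N < p -> m.*2 < p) ->
  'C(m.*2, m) <= m.*2 ^ r.+1 * primorial N.
Proof.
move=> m0 Nm mr nop; set c := 'C(_, _).
have c0 : 0 < c by rewrite bin_gt0 -addnn leq_addr.
have m20 : 0 < m.*2 by rewrite double_gt0.
have lb p : prime p -> logn p c <= trunc_log p m.*2.
  by move=> pp; apply: logn_central_bin.
have : c = \prod_(0 <= p < (maxn c N).+1) p ^ logn p c.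
  by rewrite -{1}(partnT c0) (widen_partn _ (leq_maxl c N)); apply: eq_bigl.
rewrite (big_cat_nat _ (n := N.+1)) //=; last by rewrite ltnS leq_maxr.
rewrite [X in _ * X]big1_seq ?muln1 => [->|p]; last first.
  rewrite mem_index_iota => /andP[_ /andP[Np _]].
  case pp: (prime p); last by rewrite lognE pp.
  suff -> : logn p c = 0 by [].
  apply/eqP; rewrite -leqn0 (leq_trans (lb _ pp)) // leqn0 trunc_log_eq0.
  by have := nop _ pp Np; lia.
apply: (@leq_trans (\prod_(0 <= p < N.+1)
    ((if p <= r then m.*2 else 1) * (if prime p then p else 1)))).
  apply: leq_prod => p _; case pp: (prime p); last first.
    by rewrite lognE pp muln1; case: ifP.
  have p1 := prime_gt1 pp; case: (leqP p r) => pr.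
    apply: (@leq_trans m.*2); last by rewrite leq_pmulr // prime_gt0.
    apply: leq_trans (trunc_logP p1 m20).
    by rewrite leq_exp2l // lb.
  rewrite mul1n -[leqRHS]expn1 leq_exp2l // (leq_trans (lb _ pp)) //.
  rewrite -ltnS; rewrite ltnNge; apply/negP => H.
  have := trunc_logP p1 m20; rewrite leqNgt => /negP; apply.
  apply: leq_trans mr _; apply: leq_trans (_ : p ^ 2 <= _).
    by rewrite leq_exp2r.
  by rewrite leq_exp2l.
rewrite big_split /= -[X in _ * X <= _]big_mkcond /= leq_mul2r; apply/orP; right.
rewrite -big_mkcond /= big_const_seq iter_muln_1 leq_pexp2l //.
rewrite -size_filter -[leqRHS](size_iota 0); apply: uniq_leq_size.
  by rewrite filter_uniq ?iota_uniq.
by move=> p; rewrite mem_filter !mem_iota add0n => /andP[].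
Qed.

(** With [m = 5 * N] and no prime in [(N, 10N]], the previous bound would give
    [2 ^ (5N) <= (10N) ^ O(sqrt N) * 16 ^ N]. Since [16 ^ N = 2 ^ (4N)], this fails for large
    [N]. *)
Lemma exists_prime_between :
  exists N0, forall N, N0 <= N -> exists2 p, prime p & N < p <= 10 * N.
Proof.
have growth h : 12 <= h -> 256 * h < 2 ^ h.
  elim: h => // h IH; rewrite leq_eqVlt => /orP[/eqP <- //|].
  by rewrite ltnS => /[dup] ? /IH; rewrite expnS; lia.
exists (2 ^ 20) => N NB.
have N0 : 0 < N by apply: leq_trans NB; rewrite expn_gt0.
case: (boolP (has prime (iota N.+1 (9 * N)))) => [/hasP[p]|/hasPn np].
  by rewrite mem_iota => H pp; exists p => //; lia.
pose b := trunc_log 2 N; have /andP[b1 b2] := trunc_log_bounds (isT : 1 < 2) N0.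
rewrite -/b in b1 b2.
have b20 : 20 <= b by apply: trunc_log_max.
have N10 : 10 * N < 2 ^ (b + 5).
  by rewrite expnD (_ : 2 ^ 5 = 32) //; move: b2; rewrite expnS; lia.
set m := 5 * N; have m0 : 0 < m by rewrite /m; lia.
have m2 : m.*2 = 10 * N by rewrite /m; lia.
(* [2 ^ h] serves as the cutoff [r]: it exceeds the square root of [10 * N], but only by a bounded
   factor. *)
pose h := (b + 6)./2; have hb : b + 5 <= h * 2 <= b + 6 by rewrite /h; lia.
suff : ~~ ('C(m.*2, m) <= m.*2 ^ (2 ^ h).+1 * primorial N).
  move/negP; case; apply: central_bin_le => //; rewrite m2; first by lia.
  apply: leq_trans N10 _; apply: (@leq_trans (2 ^ (h * 2))).
    by rewrite leq_exp2l //; lia.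
    by rewrite expnM leq_exp2r // ltnW.
  move=> p pp Np; rewrite ltnNge; apply/negP => pN.
  have : ~~ prime p by apply: np; rewrite mem_iota; lia.
  by rewrite pp.
rewrite -ltnNge.
apply: leq_trans (expn2_le_bin m).
apply: leq_ltn_trans (leq_mul (leqnn _) (primorial_le N)) _.
rewrite m2 /m mulSn expnD (_ : 16 = 2 ^ 4) // -expnM.
rewrite ltn_pmul2r ?expn_gt0 //.
apply: (@leq_ltn_trans ((2 ^ (b + 5)) ^ (2 ^ h).+1)).
  by rewrite leq_exp2r // ltnW.
rewrite -expnM ltn_exp2l //; apply: leq_trans b1.
have h12 : 12 <= h by lia.
apply: (@leq_trans (2 ^ (h + (h - 6)))); last by rewrite leq_exp2l //; lia.
have := growth h h12; rewrite -{2}(subnK (_ : 6 <= h)); last by lia.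
rewrite !expnD (_ : 2 ^ 6 = 64) // => G.
have x0 : 0 < 2 ^ h by rewrite expn_gt0.
apply: (@leq_ltn_trans (h * 2 * (2 ^ h).*2)); first by apply: leq_mul; lia.
rewrite (_ : h * 2 * (2 ^ h).*2 = 2 ^ h * (h * 4)); last by lia.
by rewrite ltn_pmul2l //; lia.
Qed.

Import Order.TTheory GRing.Theory Num.Theory numFieldNormedType.Exports.
Local Open Scope ring_scope.

(** * The Cauchy-Davenport inequality *)

Section CauchyDavenport.
Variables (p : nat) (p_pr : prime p).
Implicit Types A B : {set 'F_p}.

Definition sumset A B : {set 'F_p} := [set a + b | a in A, b in B].

(** A nonempty set stable under translation by [b] contains a coset of the subgroup generated by
    [b], which is all of [F_p]. *)
Lemma Fp_translate_escape A b : A != set0 -> A != setT -> b != 0 ->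
  exists2 a, a \in A & a + b \notin A.
Proof.
case/set0Pn => a0 Aa0 AT nb; apply/exists_inP; apply: contraNT AT.
move=> /exists_inPn AS.
have stable m : a0 + b *+ m \in A.
  elim: m => [|m IH]; first by rewrite mulr0n addr0.
  by have := AS _ IH; rewrite negbK mulrSr addrA.
apply/eqP/setP => x; rewrite inE.
have -> : x = a0 + b *+ ((x - a0) / b : 'F_p).
  rewrite -mulr_natr natr_Zp mulrC divfK // addrC subrK //.
exact: stable.
Qed.

(** Induction on [#|B|]. The normalization [0 \in B] puts [A] inside the sumset, which settles
    [A = F_p] and [#|B| = 1]. Otherwise a translate escaping [A] lets [B] shrink while [#|A| + #|B|]
    is kept. *)
Lemma cauchy_davenport A B : A != set0 -> 0 \in B ->
  (minn p (#|A| + #|B|.-1) <= #|sumset A B|)%N.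
Proof.
move: {2}#|B| (leqnn #|B|) => m; elim/ltn_ind: m A B => m IH A B Bm A0 B0.
have subA : A \subset sumset A B.
  by apply/subsetP => a Aa; apply/imset2P; exists a 0; rewrite ?addr0.
have [AT|AT] := eqVneq A setT.
  rewrite geq_min; apply/orP; left; rewrite -[X in (X <= _)%N](card_Fp p_pr) -cardsT -AT.
  exact: subset_leq_card.
have [B1|] := leqP #|B| 1.
  rewrite geq_min; apply/orP; right; apply: leq_trans (subset_leq_card subA).
  by lia.
move=> B1; have [b nb Bb] : exists2 b, b != 0 & b \in B.
  have : (0 < #|B :\ (0%R : 'F_p)|)%N by move: B1; rewrite (cardsD1 0 B) B0 ltnS.
  by case/card_gt0P=> b; rewrite !inE => /andP[]; exists b.
have [a Aa Aab] := Fp_translate_escape A0 AT nb.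
(* Dyson's e-transform. *)
pose T := [set a + x | x in B]; pose A' := A :|: T.
pose B' := [set x in B | a + x \in A].
have B'B : (#|B'| < #|B|)%N.
  apply: proper_card; apply/properP; split.
    by apply/subsetP => x; rewrite inE => /andP[].
  by exists b; rewrite // inE Bb.
have cT : #|T| = #|B| by apply: card_imset; apply: addrI.
have cI : #|A :&: T| = #|B'|.
  have <- : #|[set a + x | x in B']| = #|B'| by apply: card_imset; apply: addrI.
  congr #|pred_of_set _|; apply/setP => y; rewrite inE; apply/andP/imsetP.
    by case=> Ay /imsetP[x Bx E]; exists x => //; rewrite inE Bx -E.
  by case=> x; rewrite inE => /andP[Bx Ax] ->; split => //; apply: imset_f.
have := IH #|B'| (leq_trans B'B Bm) A' B' (leqnn _).
have -> : A' != set0 by apply/set0Pn; exists a; rewrite inE Aa.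
have -> : 0 \in B' by rewrite inE B0 addr0.
move=> /(_ isT isT) IH'.
have cU := cardsUI A T; rewrite -/A' cI cT in cU.
have B'0 : (0 < #|B'|)%N by apply/card_gt0P; exists 0; rewrite inE B0 addr0.
have sub : sumset A' B' \subset sumset A B.
  apply/subsetP => y /imset2P[x z]; rewrite !inE => /orP[Ax|/imsetP[u Bu ->]].
    by move=> /andP[Bz _] ->; apply/imset2P; exists x z.
  move=> /andP[Bz Az] ->; apply/imset2P; exists (a + z) u => //.
  by rewrite addrAC.
apply: leq_trans (subset_leq_card sub); apply: leq_trans IH'.
rewrite (_ : #|A| + #|B|.-1 = #|A'| + #|B'|.-1)%N //.
by move: #|A'| #|A| #|B'| #|B| cU B'B B'0 => x y z t; clear; lia.
Qed.

Fixpoint iter_sumset k B : {set 'F_p} :=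
  if k is k'.+1 then sumset (iter_sumset k' B) B else [set 0].

Lemma card_iter_sumset k B : 0 \in B ->
  (minn p (k * #|B|.-1).+1 <= #|iter_sumset k B|)%N.
Proof.
move=> B0; elim: k => [|k IH] /=; first by rewrite cards1 mul0n geq_minr.
have nz : iter_sumset k B != set0.
  rewrite -card_gt0; apply: leq_trans IH.
  by rewrite leq_min prime_gt0.
apply: leq_trans (cauchy_davenport nz B0).
have arith (a b c : nat) : (minn p a.+1 <= b -> minn p (c + a).+1 <= minn p (b + c))%N.
  by clear; lia.
by rewrite mulSn; apply: arith.
Qed.

End CauchyDavenport.

(** * Characters of F_p *)

Section ComplexModulus.
Variable R : realType.
Implicit Types z : R[i].

(** The norm of [R[i]] takes values in [R[i]]; this brings it down to [R], where it is compared with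
    real exponentials. *)
Definition modulus z : R := complex.Re `|z|.

Lemma modulusE z : `|z| = ((modulus z)%:C)%C.
Proof. by rewrite /modulus normc_def. Qed.

Lemma modulus_ge0 z : 0 <= modulus z.
Proof. by rewrite /modulus normc_def sqrtr_ge0. Qed.

Lemma modulusM z1 z2 : modulus (z1 * z2) = modulus z1 * modulus z2.
Proof. by apply: complexI; rewrite rmorphM /= -!modulusE normrM. Qed.

Lemma modulusD z1 z2 : modulus (z1 + z2) <= modulus z1 + modulus z2.
Proof. by rewrite -lecR rmorphD /= -!modulusE ler_normD. Qed.

Lemma modulus_nat m : modulus m%:R = m%:R.
Proof. by apply: complexI; rewrite -modulusE normr_nat rmorph_nat. Qed.

Lemma modulus0 : modulus 0 = 0. Proof. exact: (modulus_nat 0). Qed.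

Lemma modulus1 : modulus 1 = 1. Proof. exact: (modulus_nat 1). Qed.

Lemma modulus_sqr z : modulus z ^+ 2 = complex.Re z ^+ 2 + complex.Im z ^+ 2.
Proof. by rewrite /modulus normc_def /= sqr_sqrtr // addr_ge0 // sqr_ge0. Qed.

Lemma modulus_prod (I : Type) (r : seq I) (P : pred I) (F : I -> R[i]) :
  modulus (\prod_(i <- r | P i) F i) = \prod_(i <- r | P i) modulus (F i).
Proof.
by apply: big_morph; [exact: modulusM | exact: modulus1].
Qed.

Lemma modulus_sum (I : Type) (r : seq I) (P : pred I) (F : I -> R[i]) :
  modulus (\sum_(i <- r | P i) F i) <= \sum_(i <- r | P i) modulus (F i).
Proof.
elim/big_rec2: _ => [|i x y _ IH]; first by rewrite modulus0.
by apply: le_trans (modulusD _ _) _; rewrite lerD2l.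
Qed.

Lemma Re_sum (I : Type) (r : seq I) (P : pred I) (F : I -> R[i]) :
  complex.Re (\sum_(i <- r | P i) F i) = \sum_(i <- r | P i) complex.Re (F i).
Proof. by apply: big_morph => // - [a b] [c d]. Qed.

End ComplexModulus.

(** Any root of [1 + X + ... + X ^ (p - 1)] works; it is not 1, since the value there is
    [p != 0]. *)
Lemma exists_root_of_unity (C : numClosedFieldType) (p : nat) : prime p ->
  exists2 w : C, w ^+ p = 1 & w != 1.
Proof.
move=> pp; have p0 := prime_gt0 pp.
have [w rw] : exists w : C, root (\poly_(i < p) 1) w.
  apply/closed_rootP; rewrite size_poly_eq ?oner_neq0 // neq_ltn prime_gt1 ?orbT //.
have sw : \sum_(i < p) w ^+ i = 0.
  move/rootP: rw; rewrite horner_poly => H; rewrite -[RHS]H.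
  by apply: eq_bigr => i _; rewrite mul1r.
exists w; first by apply/eqP; rewrite -subr_eq0 subrX1 sw mulr0.
apply/eqP => w1; move: sw; rewrite w1.
under eq_bigr do rewrite expr1n.
by rewrite sumr_const card_ord => /eqP; rewrite pnatr_eq0 eqn0Ngt p0.
Qed.

Section Characters.
Variables (R : realType) (p : nat) (p_pr : prime p) (w : R[i]).
Hypotheses (wp : w ^+ p = 1) (w1 : w != 1).

Definition chr (x : 'F_p) : R[i] := w ^+ (x : nat).

Lemma chr0 : chr 0 = 1. Proof. by rewrite /chr expr0. Qed.

Lemma chr_nat m : chr m%:R = w ^+ m.
Proof. by rewrite /chr val_Fp_nat // expr_mod. Qed.

Lemma chrD x y : chr (x + y) = chr x * chr y.
Proof. by rewrite -[x]natr_Zp -[y]natr_Zp -natrD !chr_nat exprD. Qed.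

Lemma chr_sum (I : Type) (r : seq I) (P : pred I) (F : I -> 'F_p) :
  chr (\sum_(i <- r | P i) F i) = \prod_(i <- r | P i) chr (F i).
Proof. by apply: big_morph; [exact: chrD | exact: chr0]. Qed.

Lemma chr_neq1 x : x != 0 -> chr x != 1.
Proof.
move=> x0; apply: contra w1 => /eqP cx.
(* [w] is a power of [chr x], the exponent being a representative of [x^-1]; so [chr x = 1] would
   force [w = 1]. *)
have -> : w = chr (x * x^-1) by rewrite divff // -[1]/(1%:R) chr_nat expr1.
rewrite -[x^-1]natr_Zp mulr_natr; apply/eqP.
elim: (nat_of_ord _) => [|m IH]; first by rewrite mulr0n chr0.
by rewrite mulrS chrD cx IH mulr1.
Qed.

(** Orthogonality: shifting [t] by 1 multiplies the sum by [chr x], which differs from 1 unless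
    [x = 0]. *)
Lemma sum_chr x : \sum_t chr (t * x) = (p * (x == 0))%:R.
Proof.
have [->|x0] := eqVneq x 0.
  under eq_bigr do rewrite mulr0 chr0.
  by rewrite sumr_const card_Fp // muln1.
have : (chr x - 1) * (\sum_t chr (t * x)) = 0.
  rewrite mulrBl mul1r mulr_sumr [X in _ - X](reindex_inj (addIr 1)) /=.
  apply/eqP; rewrite subr_eq0; apply/eqP/eq_bigr => t _.
  by rewrite mulrDl mul1r chrD mulrC.
move/eqP; rewrite mulf_eq0 subr_eq0 (negPf (chr_neq1 x0)) /= => /eqP ->.
by rewrite muln0.
Qed.

Lemma modulus_chr x : modulus (chr x) = 1.
Proof.
suff H : modulus w = 1.
  rewrite /chr; elim: (nat_of_ord x) => [|m IH]; first by rewrite expr0 modulus1.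
  by rewrite exprS modulusM H IH mulr1.
apply/eqP; rewrite -(eqrXn2 (prime_gt0 p_pr)) ?modulus_ge0 // expr1n; apply/eqP.
have -> : modulus w ^+ p = modulus (w ^+ p).
  elim: (p) => [|m IH]; first by rewrite !expr0 modulus1.
  by rewrite !exprS modulusM IH.
by rewrite wp modulus1.
Qed.

(* If w = exp(2 i pi / p), this is sin (pi x / p) ^+ 2. *)
Definition sinsq (x : 'F_p) : R := (1 - complex.Re (chr x)) / 2.

Lemma chr_circle x : complex.Re (chr x) ^+ 2 + complex.Im (chr x) ^+ 2 = 1.
Proof. by rewrite -modulus_sqr modulus_chr expr1n. Qed.

Lemma modulus_1Bchr x : modulus (1 - chr x) ^+ 2 = 4 * sinsq x.
Proof.
have := chr_circle x; rewrite modulus_sqr /sinsq.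
case: (chr x) => a b /=; nra.
Qed.

Lemma modulus_1Dchr x : modulus (1 + chr x) ^+ 2 = 4 * (1 - sinsq x).
Proof.
have := chr_circle x; rewrite modulus_sqr /sinsq.
case: (chr x) => a b /=; nra.
Qed.

Lemma sinsq_ge0 x : 0 <= sinsq x.
Proof. by have := modulus_1Bchr x; have := sqr_ge0 (modulus (1 - chr x)); lra. Qed.

Lemma sinsq_le1 x : sinsq x <= 1.
Proof. by have := modulus_1Dchr x; have := sqr_ge0 (modulus (1 + chr x)); lra. Qed.

Lemma sinsq0 : sinsq 0 = 0.
Proof. by rewrite /sinsq chr0 /= subrr mul0r. Qed.

(** Triangle inequality for [|1 - chr|], then a weighted square: [(k + 1) * (a ^ 2 + k * b ^ 2) - k
    * (a + b) ^ 2] equals [(a - k * b) ^ 2]. The weight is free so that sums of many terms lose no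
    more than necessary. *)
Lemma sinsqD (k : nat) x y : (0 < k)%N ->
  k%:R * sinsq (x + y) <= k.+1%:R * (sinsq x + k%:R * sinsq y).
Proof.
move=> k0; set a := modulus (1 - chr x); set b := modulus (1 - chr y).
have d : modulus (1 - chr (x + y)) <= a + b.
  have -> : 1 - chr (x + y) = (1 - chr x) + chr x * (1 - chr y).
    by rewrite chrD; ring.
  by apply: le_trans (modulusD _ _) _; rewrite modulusM modulus_chr mul1r.
have d2 : 4 * sinsq (x + y) <= (a + b) ^+ 2.
  rewrite -modulus_1Bchr ler_sqr ?nnegrE ?modulus_ge0 //.
  by rewrite addr_ge0 ?modulus_ge0.
have := modulus_1Bchr x; have := modulus_1Bchr y; rewrite -/a -/b => eb ea.
have K0 : 0 <= k%:R :> R by rewrite ler0n.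
rewrite -(ler_pM2l (ltr0Sn R 3)) mulrCA; apply: le_trans (ler_wpM2l K0 d2) _.
have -> : 4 * (k.+1%:R * (sinsq x + k%:R * sinsq y)) = 
    k.+1%:R * (4 * sinsq x + k%:R * (4 * sinsq y)) by ring.
rewrite -ea -eb -natr1 -subr_ge0.
by rewrite (_ : _ - _ = (a - k%:R * b) ^+ 2) ?sqr_ge0 //; ring.
Qed.

Lemma sum_sinsq x : x != 0 -> \sum_t sinsq (t * x) = p%:R / 2.
Proof.
move=> x0; rewrite -mulr_suml sumrB sumr_const card_Fp // -Re_sum sum_chr.
by rewrite (negPf x0) muln0 subr0.
Qed.

Lemma modulus_1Dchr_le x : modulus (1 + chr x) <= 2 * expR (- (sinsq x / 2)).
Proof.
rewrite -ler_sqr ?nnegrE ?modulus_ge0 ?mulr_ge0 ?expR_ge0 //.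
rewrite modulus_1Dchr exprMn (_ : 2 ^+ 2 = 4 :> R); last by ring.
rewrite ler_pM2l // expr2 -expRD.
by apply: le_trans (expR_ge1Dx _); lra.
Qed.

End Characters.

(** * Halasz' inequality *)

Lemma ler_sum_subset (R : numDomainType) (T : finType) (A B : {set T}) (f : T -> R) :
  (forall t, t \in B -> 0 <= f t) -> A \subset B ->
  \sum_(t in A) f t <= \sum_(t in B) f t.
Proof.
move=> f0 /setIidPr AB; rewrite [leRHS](big_setID A) /= AB lerDl.
by apply: sumr_ge0 => t; rewrite inE => /andP[_ /f0].
Qed.

Lemma ler_sum_card (R : numDomainType) (T : finType) (A : {set T}) (f : T -> R) b c :
  (forall t, t \in A -> f t <= c) -> 0 <= c -> #|A|%:R <= b ->
  \sum_(t in A) f t <= b * c.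
Proof.
move=> fc c0 Ab; apply: le_trans (ler_sum _ fc) _.
by rewrite sumr_const -mulr_natl ler_wpM2r.
Qed.

Section Halasz.
Variables (R : realType) (p : nat) (p_pr : prime p) (w : R[i]).
Hypotheses (wp : w ^+ p = 1) (w1 : w != 1).
Local Notation chr := (@chr R p w).
Local Notation sinsq := (@sinsq R p w).
Variable J : finType.
Implicit Types v : J -> 'F_p.

Definition zero_sums v : {set {set J}} := [set S : {set J} | \sum_(j in S) v j == 0].

Definition energy v t : R := \sum_j sinsq (t * v j).

Definition level_set v (m : R) : {set 'F_p} := [set t | energy v t <= m].

(** Orthogonality detects the zero sums; for fixed [t] the sum over all subsets factorizes into a
    product of [1 + chr (t * v j)], whose moduli are bounded by exponentials. *)
Lemma zero_sums_fourier v :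
  (p * #|zero_sums v|)%:R <= 2 ^+ #|J| * \sum_t expR (- (energy v t / 2)).
Proof.
have E : (p * #|zero_sums v|)%:R = \sum_t \prod_j (1 + chr (t * v j)) :> R[i].
  transitivity (\sum_(S : {set J}) \sum_t chr (t * \sum_(j in S) v j)).
    under eq_bigr do rewrite sum_chr //.
    rewrite -natr_sum -big_distrr /= -big_mkcond /= sum1_card.
    by congr (_ * _)%:R; apply: eq_card => S; rewrite inE.
  rewrite exchange_big; apply: eq_bigr => t _.
  under [RHS]eq_bigr do rewrite addrC.
  rewrite bigA_distr; apply: eq_bigr => S _.
  rewrite mulr_sumr chr_sum // big_mkcond.
  by apply: eq_bigr => j _; case: ifP.
rewrite -[leLHS]modulus_nat E; apply: le_trans (modulus_sum _ _ _) _.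
rewrite mulr_sumr; apply: ler_sum => t _; rewrite modulus_prod.
apply: le_trans (_ : \prod_j (2 * expR (- (sinsq (t * v j) / 2))) <= _).
  by apply: ler_prod => j _; rewrite modulus_ge0 modulus_1Dchr_le.
rewrite big_split /= prodr_const cardT -cardE ler_pM2l ?exprn_gt0 //.
by rewrite -expR_sum sumrN mulr_suml.
Qed.

Lemma energy_ge0 v t : 0 <= energy v t.
Proof. by apply: sumr_ge0 => j _; apply: sinsq_ge0. Qed.

Lemma energy0 v : energy v 0 = 0.
Proof. by rewrite /energy big1 // => j _; rewrite mul0r sinsq0. Qed.

Lemma energyD v (k : nat) t u : (0 < k)%N ->
  k%:R * energy v (t + u) <= k.+1%:R * (energy v t + k%:R * energy v u).
Proof.
move=> k0; rewrite /energy !mulr_sumr -big_split /= mulr_sumr.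
by apply: ler_sum => j _; rewrite mulrDl; apply: sinsqD.
Qed.

(** Adding one more summand to [k] of them with weight [k] in [energyD] turns the factor [k ^ 2]
    into exactly [(k + 1) ^ 2]. *)
Lemma energy_iter_sumset v m (k : nat) t : 
  t \in iter_sumset k (level_set v m) -> energy v t <= (k ^ 2)%:R * m.
Proof.
elim: k t => [|k IH] t /=; first by rewrite inE => /eqP ->; rewrite energy0 mul0r.
case/imset2P => x y Bx; rewrite inE => ym -> {t}; have := IH _ Bx.
case: k {IH} Bx => [|k] /= Bx xm.
  by move: Bx; rewrite inE => /eqP ->; rewrite add0r mul1r.
have k0 : 0 < k.+1%:R :> R by rewrite ltr0n.
rewrite -(ler_pM2l k0); apply: le_trans (energyD _ _ _ _) _ => //.
rewrite [leRHS](_ : _ = k.+2%:R * ((k.+1 ^ 2)%:R * m + k.+1%:R * m)); last first.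
  by rewrite !natrX -[k.+2%:R]natr1; ring.
by rewrite ler_pM2l ?ltr0n // lerD // ler_pM2l.
Qed.

(** The [k]-fold sumset of the lower level set lies in the higher one. As the latter is not all of
    [F_p], the minimum in Cauchy-Davenport is not [p]. *)
Lemma card_level_set v m (k : nat) : 0 <= m ->
  (#|level_set v ((k ^ 2)%:R * m)| < p)%N ->
  (k * #|level_set v m|.-1 < #|level_set v ((k ^ 2)%:R * m)|)%N.
Proof.
move=> m0 lt_p; have in0 : 0 \in level_set v m by rewrite inE energy0.
have sub : iter_sumset k (level_set v m) \subset level_set v ((k ^ 2)%:R * m).
  by apply/subsetP => t /energy_iter_sumset; rewrite inE.
have := leq_trans (card_iter_sumset p_pr k in0) (subset_leq_card sub).
by rewrite geq_min => /orP[|//]; rewrite leqNgt lt_p.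
Qed.

(** Slice by energy at the levels [N / 4 ^ i]. A slice has at most [B / 2 ^ i] points, each of
    weight at most [4 / energy <= 4 * 4 ^ (i + 1) / N], so the slices grow geometrically in [i] and
    sum to [O(B / sqrt N)]. Points above level [N] weigh at most [4 / N] each. *)
Lemma halasz v (N B : R) : 0 < N -> 0 <= B -> #|level_set v N|%:R <= B ->
  (#|level_set v N| < p)%N ->
  \sum_(t | t != 0) expR (- (energy v t / 4)) <=
    18 * B / Num.sqrt N + 4 * p%:R / N.
Proof.
move=> N0 B0 leB lt_p.
have exp_le t : 0 < energy v t -> expR (- (energy v t / 4)) <= 4 / energy v t.
  move=> e0; rewrite expRN -[4 / _]invf_div lef_pV2 ?posrE ?expR_gt0 ?divr_gt0 //.
  by apply: le_trans (expR_ge1Dx _); rewrite lerDr.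
have sN : 0 < Num.sqrt N by rewrite sqrtr_gt0.
(* For [N < 1] the trivial bound [p] is already below [4 * p / N]. *)
have [N1|N1] := ltP N 1.
  apply: le_trans (_ : p%:R <= _).
    apply: le_trans (_ : \sum_(t : 'F_p) 1 <= _); last by rewrite sumr_const card_Fp.
    rewrite [leLHS]big_mkcond; apply: ler_sum => t _; case: ifP => // _.
    rewrite -[leRHS]expR0 ler_expR oppr_le0; apply: divr_ge0 => //.
    exact: energy_ge0.
  have : p%:R <= 4 * p%:R / N by rewrite ler_pdivlMr //; have := ler0n R p; nra.
  have : 0 <= 18 * B / Num.sqrt N by rewrite divr_ge0 ?mulr_ge0 // ltW.
  by lra.
(* The slicing stops at [1 <= N / 4 ^ I < 4], so that [2 ^ I] agrees with [sqrt N] up to a factor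
   2. *)
pose I := trunc_log 4 (Num.truncn N).
have [I1 I2] : 4 ^+ I <= N /\ N < 4 ^+ I.+1.
  have /andP[t1 t2] := truncn_itv (ltW N0).
  have tr0 : (0 < Num.truncn N)%N by rewrite truncn_gt0.
  have /andP[l1 l2] := trunc_log_bounds (isT : (1 < 4)%N) tr0; rewrite -/I in l1 l2.
  rewrite -!natrX; split; first by apply: le_trans t1; rewrite ler_nat.
  by apply: lt_le_trans t2 _; rewrite ler_nat.
(* [card_level_set] with [k = 2 ^ i]; the predecessor in it corresponds to removing the point 0. *)
have small (i : nat) : #|level_set v (N / 4 ^+ i) :\ 0|%:R <= B / 2 ^+ i.
  have Ei : N = ((2 ^ i) ^ 2)%:R * (N / 4 ^+ i).
    rewrite -expnM mulnC expnM natrX mulrC divfK //.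
    by rewrite expf_neq0 // pnatr_eq0.
  have Ni : 0 <= N / 4 ^+ i by rewrite divr_ge0 ?exprn_ge0 // ltW.
  have := @card_level_set v (N / 4 ^+ i) (2 ^ i) Ni; rewrite -Ei => /(_ lt_p) H.
  rewrite ler_pdivlMr ?exprn_gt0 // -(natrX R 2 i) -natrM; apply: le_trans leB.
  rewrite ler_nat (cardsD1 0 (level_set v (N / 4 ^+ i))) in H *.
  by move: H; rewrite inE energy0 Ni add1n /= mulnC => /ltnW.
have dyadic (i : nat) :
  \sum_(t in level_set v N :\: level_set v (N / 4 ^+ i)) expR (- (energy v t / 4))
    <= 16 * 2 ^+ i * B / N.
  elim: i => [|i IH].
    rewrite expr0 divr1 setDv big_set0 divr_ge0 ?(ltW N0) // mulr_ge0 //.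
    by rewrite mulr_ge0.
  rewrite (big_setID (level_set v (N / 4 ^+ i))) /=.
  rewrite [leRHS](_ : _ = 16 * 2 ^+ i * B / N + 16 * 2 ^+ i * B / N); last first.
    by rewrite exprS; field; rewrite gt_eqF.
  apply: lerD; last first.
    apply: le_trans IH; apply: ler_sum_subset => [t _|]; first exact: expR_ge0.
    by rewrite setSD // subsetDl.
  apply: le_trans (_ : (B / 2 ^+ i) * (4 * 4 ^+ i.+1 / N) <= _); last first.
    rewrite exprS (_ : 4 ^+ i = 2 ^+ i * 2 ^+ i :> R); last first.
      by rewrite -exprMn; congr (_ ^+ _); ring.
    rewrite le_eqVlt; apply/orP; left; apply/eqP; field.
    by rewrite gt_eqF //= expf_neq0 // pnatr_eq0.
  apply: ler_sum_card => [t||].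
  - rewrite !inE -ltNge => /andP[/andP[lt_t _] _].
    have e0 : 0 < energy v t by apply: le_lt_trans lt_t; rewrite divr_ge0 ?exprn_ge0 // ltW.
    apply: le_trans (exp_le _ e0) _; rewrite -mulrA -[_ / N]invf_div ler_pM2l //.
    by rewrite lef_pV2 ?posrE ?divr_gt0 ?exprn_gt0 // ltW.
  - by rewrite divr_ge0 ?mulr_ge0 ?exprn_ge0 // ltW.
  - apply: le_trans (small i); rewrite ler_nat; apply: subset_leq_card.
    apply/subsetP => t; rewrite !inE -ltNge => /andP[/andP[lt_t _] ->].
    rewrite andbT; apply: contraTneq lt_t => ->; rewrite energy0 -leNgt.
    by rewrite divr_ge0 ?exprn_ge0 // ltW.
have -> : \sum_(t | t != 0) expR (- (energy v t / 4)) =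
    \sum_(t in [set t : 'F_p | t != 0]) expR (- (energy v t / 4)).
  by apply: eq_bigl => t; rewrite inE.
rewrite (big_setID (level_set v N)) (big_setID (level_set v (N / 4 ^+ I))) /=.
apply: lerD; last first.
  rewrite [4 * _]mulrC -mulrA; apply: ler_sum_card => [t||].
  - rewrite !inE -ltNge => /andP[lt_t _].
    have e0 := lt_trans N0 lt_t.
    by apply: le_trans (exp_le _ e0) _; rewrite ler_pM2l // lef_pV2 ?posrE // ltW.
  - by rewrite divr_ge0 // ltW.
  - by rewrite ler_nat (leq_trans (max_card _)) // card_Fp.
pose D : R := 2 ^+ I.
have D0 : 0 < D by rewrite exprn_gt0.
have D2 : 4 ^+ I = D ^+ 2 by rewrite /D -exprM mulnC exprM; congr (_ ^+ _); ring.
have D1 : D <= Num.sqrt N.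
  by rewrite -ler_sqr ?nnegrE ?(ltW D0) ?(ltW sN) // sqr_sqrtr ?(ltW N0) // -D2.
have D3 : Num.sqrt N <= 2 * D.
  rewrite -ler_sqr ?nnegrE ?(ltW sN) ?mulr_ge0 ?(ltW D0) //
    sqr_sqrtr ?(ltW N0) // exprMn -D2.
  by apply/ltW/(lt_le_trans I2); rewrite exprS ler_pM2r ?exprn_gt0 //; lra.
(* The share 2 pays for the points of the innermost level set, each of weight at most 1, and the
   share 16 for the slices. *)
rewrite (_ : 18 * B / Num.sqrt N = 2 * B / Num.sqrt N + 16 * B / Num.sqrt N); last first.
  by rewrite -!mulrDl; congr (_ * _ / _); ring.
apply: lerD.
  apply: le_trans (_ : B / D * 1 <= _); last first.
    rewrite mulr1 ler_pdivrMr // mulrAC ler_pdivlMr //.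
    by rewrite [2 * B]mulrC -mulrA ler_wpM2l.
  apply: ler_sum_card => // [t _|].
    rewrite -[leRHS]expR0 ler_expR oppr_le0; apply: divr_ge0 => //; exact: energy_ge0.
  apply: le_trans (small I); rewrite ler_nat; apply: subset_leq_card.
  by apply/subsetP => t; rewrite !inE => /andP[/andP[-> _] ->].
apply: le_trans (_ : 16 * D * B / N <= _).
  apply: le_trans (dyadic I); apply: ler_sum_subset => [t _|]; first exact: expR_ge0.
  by rewrite setSD // subsetIr.
rewrite ler_pdivrMr // (_ : _ / _ * N = 16 * Num.sqrt N * B).
  by rewrite ler_wpM2r // ler_pM2l.
by rewrite -{2}(sqr_sqrtr (ltW N0)); field; rewrite gt_eqF.
Qed.

(** An averaging argument: over all [t], the part [q] of the energy coming from [A] has mean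
    [k / 2]. Since [q <= k] everywhere and [q <= k / 8] on the level set, that set cannot fill more
    than 4/7 of [F_p]. *)
Lemma card_level_nonzero v (A : {set J}) :
  A != finset.set0 -> (forall j, j \in A -> v j != 0) ->
  7 * #|level_set v (#|A|%:R / 8)|%:R <= 4 * p%:R :> R.
Proof.
rewrite -card_gt0 => A0 vA; set k := #|A| in A0 *; set T := level_set _ _.
have k0 : 0 < k%:R :> R by rewrite ltr0n.
pose q t := \sum_(j in A) sinsq (t * v j).
have q_le t : q t <= energy v t.
  rewrite /energy (bigID (mem A)) /= lerDl; apply: sumr_ge0 => j _.
  exact: sinsq_ge0.
have q_lek t : q t <= k%:R.
  apply: le_trans (_ : \sum_(j in A) 1 <= _); last by rewrite sumr_const.
  by apply: ler_sum => j _; apply: sinsq_le1.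
have sum_q : \sum_t q t = k%:R * (p%:R / 2).
  rewrite exchange_big /= (eq_bigr (fun=> p%:R / 2)) => [|j jA].
    by rewrite sumr_const [RHS]mulr_natl.
  by rewrite sum_sinsq // vA.
have : \sum_t q t <= \sum_(t : 'F_p) (if t \in T then k%:R / 8 else k%:R).
  apply: ler_sum => t _; rewrite inE; case: ifP => // H.
  exact: le_trans (q_le t) H.
rewrite sum_q [leRHS](_ : _ = \sum_(t : 'F_p) (k%:R - (t \in T)%:R * (7 * k%:R / 8))); last first.
  apply: eq_bigr => t _; case: ifP => _ /=; by field.
rewrite sumrB sumr_const card_Fp // -mulr_suml -natr_sum -big_mkcond /= sum1_card.
rewrite -[k%:R *+ p]mulr_natl; move: (#|T|%:R) (p%:R) (k%:R) k0 => a b x x0 H.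
by rewrite -(ler_pM2l x0); lra.
Qed.

(** Parseval: the sum of [|X t| ^ 2] is [p] times the number of pairs of coordinates with equal
    values, hence at most [p * k * L]. On the level set the real part of [X t] is
    [k - 2 * energy >= 3k / 4], so each of its points uses up [9k ^ 2 / 16]. *)
Lemma card_level_flat v (L : nat) :
  (forall i, #|[set j | v j == v i]| <= L)%N ->
  9 * #|level_set v (#|J|%:R / 8)|%:R * #|J|%:R <= 16 * p%:R * L%:R :> R.
Proof.
move=> vL; set k := #|J|; set T := level_set _ _.
have [k0|k0] := posnP k; first by rewrite k0 mulr0 mulr_ge0 ?mulr_ge0.
have {}k0 : 0 < k%:R :> R by rewrite ltr0n.
pose X t := \sum_j chr (t * v j).
have big_X t : t \in T -> 9 * k%:R ^+ 2 / 16 <= modulus (X t) ^+ 2.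
  rewrite inE => Tt; have E : complex.Re (X t) = k%:R - 2 * energy v t.
    have -> : k%:R = \sum_(j : J) 1 :> R by rewrite sumr_const.
    rewrite /X Re_sum /energy mulr_sumr -sumrB.
    by apply: eq_bigr => j _; rewrite /sinsq; field.
  rewrite modulus_sqr; have := sqr_ge0 (complex.Im (X t)); move: E Tt k0.
  by move: (complex.Re _) (complex.Im _) (energy _ _) (k%:R) => a b c d; nra.
have norm_chr x : `|chr x| = 1 by rewrite modulusE modulus_chr.
have conj_chr x : (chr x)^* = chr (- x).
  have nz : chr x != 0 by rewrite -normr_eq0 norm_chr oner_neq0.
  by apply: (mulfI nz); rewrite -normCK norm_chr expr1n -chrD // subrr chr0.
have sum_X : \sum_t modulus (X t) ^+ 2 = p%:R * \sum_i #|[set j | v j == v i]|%:R.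
  apply: complexI; rewrite rmorph_sum rmorphM rmorph_nat rmorph_sum /=.
  under eq_bigr do rewrite rmorphXn /= -modulusE normCK /X rmorph_sum mulr_suml /=.
  rewrite exchange_big mulr_sumr; apply: eq_bigr => i _.
  under eq_bigr do rewrite mulr_sumr; rewrite exchange_big /=.
  rewrite rmorph_nat -natrM -sum1dep_card big_distrr natr_sum /= [RHS]big_mkcond.
  apply: eq_bigr => j _.
  under eq_bigr do rewrite conj_chr -chrD // -mulrBr.
  by rewrite sum_chr // subr_eq0 [v i == _]eq_sym; case: eqP => _; rewrite ?muln0.
have : #|T|%:R * (9 * k%:R ^+ 2 / 16) <= p%:R * (k%:R * L%:R) :> R.
  apply: le_trans (_ : \sum_t modulus (X t) ^+ 2 <= _).
    rewrite mulr_natl -sumr_const [leRHS](bigID (mem T)) /=.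
    apply: le_trans (ler_sum _ big_X) _; rewrite lerDl.
    by apply: sumr_ge0 => t _; apply: sqr_ge0.
  rewrite sum_X ler_wpM2l // mulr_natl -sumr_const; apply: ler_sum => i _.
  by rewrite ler_nat.
move: (#|T|%:R) (p%:R) (L%:R) (k%:R) k0 => a b c x x0 H.
by rewrite -(ler_pM2l x0); lra.
Qed.

End Halasz.

(** * Fourier sums for many nonzero coordinates or no frequent value, and moments over all
    vectors *)

Section HalaszConsequences.
Variables (R : realType) (p : nat) (p_pr : prime p) (w : R[i]).
Hypotheses (wp : w ^+ p = 1) (w1 : w != 1).
Local Notation sinsq := (@sinsq R p w).

Lemma sqrt_div8 (x : R) : 0 < x -> (Num.sqrt (x / 8))^-1 <= 3 / Num.sqrt x.
Proof.
move=> x0; rewrite -[3 / _]invf_div lef_pV2 ?posrE ?divr_gt0 ?sqrtr_gt0 ?divr_gt0 //.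
rewrite -ler_sqr ?nnegrE ?divr_ge0 ?sqrtr_ge0 //.
by rewrite expr_div_n !sqr_sqrtr ?divr_ge0 ?(ltW x0) //; lra.
Qed.

Lemma inv_le_inv_sqrt (k : nat) : (0 < k)%N -> k%:R^-1 <= (Num.sqrt k%:R)^-1 :> R.
Proof.
move=> k0; have k1 : 1 <= k%:R :> R by rewrite ler1n.
rewrite lef_pV2 ?posrE ?sqrtr_gt0 ?ltr0n //.
rewrite -ler_sqr ?nnegrE ?sqrtr_ge0 // sqr_sqrtr //; nra.
Qed.

(** Halasz' inequality at level [#|A| / 8], below which at most 4/7 of all [t] lie. As [sqrt 8 < 3],
    the constants add up to [18 * (4 / 7) * 3 + 32 < 64]. *)
Lemma halasz_nonzero (J : finType) (v : J -> 'F_p) (A : {set J}) :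
  A != finset.set0 -> (forall j, j \in A -> v j != 0) ->
  \sum_(t | t != 0) expR (- (energy w v t / 4)) <= 64 * p%:R / Num.sqrt #|A|%:R.
Proof.
move=> A0 vA; have cT := card_level_nonzero p_pr wp w1 A0 vA.
rewrite -card_gt0 in A0; have k0 : 0 < #|A|%:R :> R by rewrite ltr0n.
have p0 : 0 < p%:R :> R by rewrite ltr0n prime_gt0.
apply: le_trans (halasz p_pr wp (v := v) (N := #|A|%:R / 8) (B := 4 / 7 * p%:R) _ _ _ _) _.
- by rewrite divr_gt0.
- by move: p0; lra.
- by move: cT; lra.
- by rewrite -(ltr_nat R); move: cT p0; lra.
have := sqrt_div8 k0; have := inv_le_inv_sqrt A0.
rewrite -[4 * _ / _]mulrA invf_div.
have : 0 < (Num.sqrt #|A|%:R)^-1 :> R by rewrite invr_gt0 sqrtr_gt0.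
move: (Num.sqrt (_ / 8))^-1 (Num.sqrt _)^-1 => x y y0 H1 H2.
apply: le_trans (_ : 18 * (4 / 7 * p%:R) * (3 * y) + 4 * (p%:R * (8 * y)) <= _).
  apply: lerD; first by rewrite ler_wpM2l // mulr_ge0 // mulr_ge0 // divr_ge0.
  by rewrite ler_pM2l // !ler_pM2l.
by have := mulr_gt0 p0 y0; lra.
Qed.

(** The condition [16 * L < 9 * #|J|] keeps the level set proper. For [L] a small fraction of a
    large [#|J|] the last factor is small, a gain that becomes exponential once the bound is raised
    to the power [n]. *)
Lemma halasz_flat (J : finType) (v : J -> 'F_p) (L : nat) :
  (0 < #|J|)%N -> (forall i, #|[set j | v j == v i]| <= L)%N ->
  (16 * L < 9 * #|J|)%N ->
  \sum_(t | t != 0) expR (- (energy w v t / 4)) <=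
    p%:R / Num.sqrt #|J|%:R * (96 * L%:R / #|J|%:R + 32 / Num.sqrt #|J|%:R).
Proof.
move=> J0 vL ltL; have cT := card_level_flat p_pr wp w1 vL.
have k0 : 0 < #|J|%:R :> R by rewrite ltr0n.
have p0 : 0 < p%:R :> R by rewrite ltr0n prime_gt0.
move: ltL; rewrite -(ltr_nat R) !natrM => ltL.
apply: le_trans (halasz p_pr wp (v := v) (N := #|J|%:R / 8) (B := 16 / 9 * p%:R * L%:R / #|J|%:R) _ _ _ _) _.
- by rewrite divr_gt0.
- by rewrite divr_ge0 // !mulr_ge0 ?invr_ge0.
- by rewrite ler_pdivlMr //; lra.
- by rewrite -(ltr_nat R) -(ltr_pM2r k0); nra.
rewrite mulrDr; apply: lerD.
  have := sqrt_div8 k0; move: (Num.sqrt (_ / 8))^-1 => x H.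
  rewrite [leRHS](_ : _ = 18 * (16 / 9 * p%:R * L%:R / #|J|%:R) * (3 / Num.sqrt #|J|%:R)).
    by rewrite ler_wpM2l // mulr_ge0 // divr_ge0 // !mulr_ge0 ?invr_ge0.
  by rewrite (_ : 96 = 18 * (16 / 9) * 3 :> R); [ring | field].
rewrite mulrACA -invfM -expr2 sqr_sqrtr //; lra.
Qed.

(** The constant vector with [k] entries 1 has energy [k * sinsq], so [halasz_nonzero] covers the
    nonzero [x]. The term at 0 is at most [p / sqrt k] because [k <= p ^ 2]; hence 65 = 1 + 64. *)
Lemma sum_exp_sinsq (k : nat) : (0 < k)%N -> (k <= p ^ 2)%N ->
  \sum_x expR (- (k%:R / 4 * sinsq x)) <= 65 * p%:R / Num.sqrt k%:R.
Proof.
move=> k0 kp; have s0 : 0 < Num.sqrt k%:R :> R by rewrite sqrtr_gt0 ltr0n.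
have := @halasz_nonzero 'I_k (fun=> 1) [set: 'I_k] _ _.
rewrite -card_gt0 cardsT card_ord => /(_ k0 (fun _ _ => oner_neq0 _)) H.
rewrite (bigD1 0) //= sinsq0 mulr0 oppr0 expR0.
rewrite (_ : 65 = 1 + 64); last by ring.
rewrite mulrDl mul1r mulrDl; apply: lerD.
  rewrite ler_pdivlMr // mul1r -ler_sqr ?nnegrE ?(ltW s0) // sqr_sqrtr // -natrX.
  by rewrite ler_nat.
apply: le_trans H; apply: ler_sum => x _; rewrite ler_expR lerN2 /energy.
by rewrite mulr1 sumr_const card_ord -[_ *+ k]mulr_natl; lra.
Qed.

Lemma expR_energy (J : finType) (v : J -> 'F_p) (c : R) t :
  expR (- (c * energy w v t)) = \prod_j expR (- (c * sinsq (t * v j))).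
Proof. by rewrite -expR_sum sumrN mulr_sumr. Qed.

(** For fixed [t != 0] the sum over [v] factorizes over coordinates, and multiplication by [t]
    permutes [F_p]. *)
Lemma moment_factorization (J : finType) (c : R) :
  \sum_(v : {ffun J -> 'F_p}) \sum_(t | t != 0) expR (- (c * energy w v t)) =
  p.-1%:R * (\sum_x expR (- (c * sinsq x))) ^+ #|J|.
Proof.
rewrite exchange_big /= (eq_bigr (fun=> (\sum_x expR (- (c * sinsq x))) ^+ #|J|)) => [|t t0].
  by rewrite sumr_const mulr_natl; congr (_ *+ _); rewrite cardC1 card_Fp.
have -> : \sum_x expR (- (c * sinsq x)) = \sum_x expR (- (c * sinsq (t * x))).
  by rewrite (reindex_inj (mulfI t0)).
rewrite -prodr_const bigA_distr_bigA /=; apply: eq_bigr => v _.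
exact: expR_energy.
Qed.

End HalaszConsequences.

(** * The density of zero sums *)

Lemma expr_1Dinv_le (R : realType) (x : R) (n : nat) :
  0 <= x -> x <= n%:R^-1 -> (1 + x) ^+ n <= expR 1.
Proof.
move=> x0 xn; case: n xn => [|n] xn; first by rewrite expr0 -[leLHS]expR0 ler_expR.
apply: le_trans (_ : (expR n.+1%:R^-1) ^+ n.+1 <= _).
  rewrite lerXn2r ?nnegrE ?addr_ge0 ?expR_ge0 //.
  by apply: le_trans (expR_ge1Dx _); rewrite lerD2l.
by rewrite -expRM_natl mulfV // pnatr_eq0.
Qed.

Section ZeroSumDensity.
Variables (R : realType) (p : nat) (p_pr : prime p) (w : R[i]).
Hypotheses (wp : w ^+ p = 1) (w1 : w != 1).
Local Notation sinsq := (@sinsq R p w).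
Variable n : nat.
Hypothesis n0 : (0 < n)%N.
Implicit Types v : {ffun 'I_n -> 'F_p}.

Definition density v : R := #|zero_sums v|%:R / 2 ^+ n.

Definition fourier_mass v : R := \sum_(t | t != 0) expR (- (energy w v t / 2)).

Let p0 : 0 < p%:R :> R. Proof. by rewrite ltr0n prime_gt0. Qed.

Lemma density_ge0 v : 0 <= density v.
Proof. by rewrite divr_ge0 // exprn_ge0. Qed.

Lemma density_le v : density v <= (1 + fourier_mass v) / p%:R.
Proof.
have := zero_sums_fourier p_pr wp w1 v; rewrite card_ord (bigD1 0) //=.
rewrite energy0 // mul0r oppr0 expR0 natrM => H.
by rewrite /density ler_pdivrMr ?exprn_gt0 // mulrAC ler_pdivlMr // [leLHS]mulrC [leRHS]mulrC.
Qed.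

Lemma fourier_mass_ge0 v : 0 <= fourier_mass v.
Proof. by apply: sumr_ge0 => t _; apply: expR_ge0. Qed.

Lemma density_small_mass v : fourier_mass v <= n%:R^-1 ->
  density v ^+ n <= expR 1 / p%:R ^+ n.
Proof.
move=> H; apply: le_trans (_ : ((1 + fourier_mass v) / p%:R) ^+ n <= _).
  by rewrite lerXn2r ?nnegrE ?density_ge0 ?density_le // divr_ge0 ?addr_ge0 ?fourier_mass_ge0.
rewrite expr_div_n ler_pM2r ?invr_gt0 ?exprn_gt0 //.
by apply: expr_1Dinv_le => //; apply: fourier_mass_ge0.
Qed.

(** A mass above [1 / n] forces some [t] with [n * p * expR (- (energy w v t / 2)) >= 1]. The [a]-th
    power of this quantity is inserted as a weight that is small on average over [v]. *)
Lemma density_medium_mass v (a : nat) :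
  n%:R^-1 < fourier_mass v -> fourier_mass v <= 1 ->
  density v ^+ n <= (2 / p%:R) ^+ n * (n * p)%:R ^+ a *
     \sum_(t | t != 0) expR (- (a%:R / 2 * energy w v t)).
Proof.
move=> F1 F2; have np0 : 0 < (n * p)%:R :> R by rewrite ltr0n muln_gt0 n0 prime_gt0.
have [t t0 Ht] : exists2 t, t != 0 & (n * p)%:R^-1 <= expR (- (energy w v t / 2)).
  apply/exists_inP; apply: contraTT F1 => /exists_inPn H; rewrite -leNgt.
  apply: le_trans (_ : \sum_(t : 'F_p | t != 0) (n * p)%:R^-1 <= _).
    by apply: ler_sum => t t0; have := H t t0; rewrite -ltNge => /ltW.
  rewrite sumr_const cardC1 card_Fp // -[_ *+ p.-1]mulr_natl ler_pdivrMr // mulrC natrM [n%:R * _]mulrC.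
  by rewrite mulfK ?pnatr_eq0 -?lt0n // ler_nat leq_pred.
rewrite -mulrA; apply: le_trans (_ : (2 / p%:R) ^+ n * 1 <= _).
  rewrite mulr1 lerXn2r ?nnegrE ?density_ge0 ?divr_ge0 //.
  by apply: le_trans (density_le v) _; rewrite ler_pM2r ?invr_gt0 //; lra.
rewrite ler_wpM2l ?exprn_ge0 ?divr_ge0 //.
apply: le_trans (_ : (n * p)%:R ^+ a * (n * p)%:R^-1 ^+ a <= _).
  by rewrite -exprMn mulfV ?expr1n // gt_eqF.
rewrite ler_pM2l ?exprn_gt0 // (bigD1 t) //=.
apply: le_trans (_ : expR (- (a%:R / 2 * energy w v t)) <= _); last first.
  by rewrite lerDl; apply: sumr_ge0 => u _; apply: expR_ge0.
rewrite (_ : - _ = a%:R * (- (energy w v t / 2))); last by ring.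
by rewrite expRM_natl lerXn2r ?nnegrE ?invr_ge0 ?expR_ge0 // ltW.
Qed.

(** Let [m] be the largest of the [expR (- (energy w v t / 4))]. Splitting each term of the mass
    into two equal factors and bounding one by [m] gives a mass of at most [m * H]; then [1 + m * H]
    may be doubled away since the mass exceeds 1, and [m ^ n] is one term of the final sum. *)
Lemma density_large_mass v (H : R) :
  1 < fourier_mass v -> \sum_(t | t != 0) expR (- (energy w v t / 4)) <= H ->
  density v ^+ n <= (2 * H / p%:R) ^+ n *
     \sum_(t | t != 0) expR (- (n%:R / 4 * energy w v t)).
Proof.
move=> F1 leH; have H0 : 0 <= H.
  by apply: le_trans leH; apply: sumr_ge0 => t _; apply: expR_ge0.
pose t0 := [arg min_(t < (1 : 'F_p) | t != 0) energy w v t]%O.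
have [t0n t0min] : t0 != 0 /\ forall t, t != 0 -> energy w v t0 <= energy w v t.
  by rewrite /t0; case: arg_minP; rewrite ?oner_neq0.
pose m := expR (- (energy w v t0 / 4)).
have m0 : 0 <= m by apply: expR_ge0.
have FmH : fourier_mass v <= m * H.
  apply: le_trans (_ : m * \sum_(t | t != 0) expR (- (energy w v t / 4)) <= _).
    rewrite mulr_sumr; apply: ler_sum => t tn.
    rewrite /m -expRD ler_expR; have := t0min t tn; lra.
  by rewrite ler_wpM2l.
apply: le_trans (_ : (2 * H / p%:R * m) ^+ n <= _).
  rewrite lerXn2r ?nnegrE ?density_ge0 ?mulr_ge0 ?invr_ge0 //.
  apply: le_trans (density_le v) _.
  rewrite mulrAC ler_pM2r ?invr_gt0 //; have := FmH; lra.
rewrite exprMn ler_wpM2l ?exprn_ge0 ?mulr_ge0 ?invr_ge0 //.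
rewrite (bigD1 t0) //= -[leLHS]addr0; apply: lerD.
  by rewrite /m -expRM_natl ler_expR; lra.
by apply: sumr_ge0 => u _; apply: expR_ge0.
Qed.

(** Toggling membership of [j] changes the sum by [v j != 0], hence maps zero sums injectively to
    nonzero sums. *)
Lemma density_half v j : v j != 0 -> density v <= 2^-1.
Proof.
move=> vj; pose f (S : {set 'I_n}) := if j \in S then S :\ j else j |: S.
have fj S : (j \in f S) = (j \notin S) by rewrite /f; case: ifP => H; rewrite !inE eqxx.
have fK : involutive f.
  move=> S; rewrite {1}/f fj; case: (boolP (j \in S)) => /= jS; rewrite /f.
    by rewrite jS setD1K.
  by rewrite (negPf jS) setU1K.
have disj : [disjoint zero_sums v & f @: zero_sums v].
  rewrite disjoint_subset; apply/subsetP => S; rewrite !inE => /eqP S0.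
  apply/imsetP => -[T]; rewrite inE => /eqP T0 ST; move: S0; rewrite ST /f.
  case: ifP => jT; last by rewrite big_setU1 ?jT //= T0 addr0 => /eqP; rewrite (negPf vj).
  move: T0; rewrite (big_setD1 j jT) /= => /eqP; rewrite addr_eq0 => /eqP vE E.
  by move: vj; rewrite vE E oppr0 eqxx.
have : (#|zero_sums v| + #|f @: zero_sums v| <= 2 ^ n)%N.
  move: (leq_card_setU (zero_sums v) (f @: zero_sums v)).2; rewrite disj => /eqP <-.
  apply: leq_trans (max_card _) _.
  by rewrite -cardsT -powersetT card_powerset cardsT card_ord.
rewrite card_imset; last exact: inv_inj fK.
rewrite addnn -mul2n -(ler_nat R) natrM natrX => H.
by rewrite /density ler_pdivrMr ?exprn_gt0 // mulrC ler_pdivlMr // mulrC.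
Qed.

(* Each factor x^-1 is paid for by one of the at most k0 nonzero coordinates. *)
Definition sparse_bound (k0 : nat) v : R :=
  (2^-1) ^+ n * (n * p)%:R ^+ k0 *
    \prod_j (if v j == 0 then 1 else (n * p)%:R^-1).

Lemma density_sparse (k0 : nat) v j : v j != 0 -> (#|[set i | v i != 0%R]| <= k0)%N ->
  density v ^+ n <= sparse_bound k0 v.
Proof.
move=> vj supp; have np0 : (0 < n * p)%N by rewrite muln_gt0 n0 prime_gt0.
rewrite /sparse_bound -mulrA; apply: le_trans (_ : (2^-1) ^+ n * 1 <= _).
  by rewrite mulr1 lerXn2r ?nnegrE ?density_ge0 ?invr_ge0 // (density_half vj).
rewrite ler_pM2l ?exprn_gt0 ?invr_gt0 //.
rewrite (bigID (fun j => v j == 0)) /= big1 ?mul1r => [|i ->] //.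
rewrite (eq_bigr (fun=> (n * p)%:R^-1)) => [|i /negPf -> //].
rewrite prodr_const -(subnK supp) exprD -mulrA.
rewrite (_ : #|[pred i | v i != 0]| = #|[set i | v i != 0%R]|); last first.
  by apply: eq_card => i; rewrite !inE.
rewrite -exprMn mulfV ?pnatr_eq0 -?lt0n // expr1n mulr1 -natrX ler1n.
by rewrite expn_gt0 np0.
Qed.

(** The product weight sums to [(1 + (p - 1) / (n * p)) ^ n <= e] over all vectors. *)
Lemma sum_sparse_bound (k0 : nat) :
  \sum_v sparse_bound k0 v <= (2^-1) ^+ n * (n * p)%:R ^+ k0 * expR 1.
Proof.
have np0 : (0 < n * p)%N by rewrite muln_gt0 n0 prime_gt0.
rewrite -mulr_sumr ler_wpM2l ?mulr_ge0 ?exprn_ge0 ?invr_ge0 //.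
rewrite -(bigA_distr_bigA (fun _ x => if x == 0 then 1 else (n * p)%:R^-1)) /=.
rewrite prodr_const card_ord (bigD1 0) //=; apply: expr_1Dinv_le.
  by apply: sumr_ge0 => x _; case: ifP => // _; rewrite invr_ge0.
rewrite (eq_bigr (fun=> (n * p)%:R^-1)) => [|x /negPf -> //].
rewrite sumr_const cardC1 card_Fp // -[_ *+ p.-1]mulr_natl ler_pdivrMr ?ltr0n //.
rewrite mulrC natrM [n%:R * _]mulrC.
by rewrite mulfK ?pnatr_eq0 -?lt0n // ler_nat leq_pred.
Qed.

(** A union bound over the set [S] of coordinates sharing one value [y]. On [S] the exponential
    factors are replaced by the indicator of that value, so the sum over [v] still factorizes. *)
Definition level_bound (H : R) (L : nat) v : R :=
  H ^+ n * \sum_(S : {set 'I_n} | (L < #|S|)%N) \sum_y \sum_(t | t != 0)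
    \prod_j (if j \in S then (v j == y)%:R
             else expR (- (n%:R / 4 * sinsq (t * v j)))).

Lemma density_level (H : R) (L : nat) v i :
  1 < fourier_mass v -> \sum_(t | t != 0) expR (- (energy w v t / 4)) <= H ->
  (L < #|[set j | v j == v i]|)%N ->
  density v ^+ n <= level_bound (2 * H / p%:R) L v.
Proof.
move=> F1 leH Li; apply: le_trans (density_large_mass F1 leH) _.
have H0 : 0 <= H.
  by apply: le_trans leH; apply: sumr_ge0 => t _; apply: expR_ge0.
rewrite /level_bound ler_wpM2l ?exprn_ge0 ?mulr_ge0 ?invr_ge0 //.
set S := [set j | v j == v i] in Li.
have pos (T : {set 'I_n}) y t : 0 <= \prod_j (if j \in T then (v j == y)%:R
     else expR (- (n%:R / 4 * sinsq (t * v j)))) :> R.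
  by apply: prodr_ge0 => j _; case: ifP => // _; apply: expR_ge0.
rewrite [leRHS](bigD1 S) //= [X in _ <= X + _](bigD1 (v i)) //= -addrA -[leLHS]addr0; apply: lerD.
  apply: ler_sum => t _; rewrite expR_energy; apply: ler_prod => j _.
  rewrite expR_ge0 /= inE; case: eqP => // _.
  rewrite -[leRHS]expR0 ler_expR oppr_le0. by apply: mulr_ge0; [exact: divr_ge0 | exact: sinsq_ge0].
by rewrite addr_ge0 //; do 3 ?[apply: sumr_ge0 => ? _].
Qed.

(** For fixed [S], [y] and [t], coordinates in [S] contribute a factor 1 and the others at most [Q];
    there are [2 ^ n] choices of [S], [p] of [y] and fewer than [p] of [t]. *)
Lemma sum_level_bound (H Q : R) (L : nat) : 0 <= H -> 1 <= Q -> (L < n)%N ->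
  \sum_x expR (- (n%:R / 4 * sinsq x)) <= Q ->
  \sum_v level_bound H L v <= H ^+ n * (2 ^+ n * p%:R * p%:R * Q ^+ (n - L.+1)).
Proof.
move=> H0 Q1 Ln leQ; rewrite -mulr_sumr ler_wpM2l ?exprn_ge0 //.
rewrite exchange_big /=.
apply: le_trans (_ : \sum_(S : {set 'I_n}) p%:R * p%:R * Q ^+ (n - L.+1) <= _); last first.
  rewrite sumr_const -cardsT -powersetT card_powerset cardsT card_ord.
  by rewrite -[_ *+ (2 ^ n)]mulr_natl natrX !mulrA.
rewrite [leLHS]big_mkcond; apply: ler_sum => S _.
case: ifP => LS; last by rewrite !mulr_ge0 ?exprn_ge0 // (le_trans ler01).
rewrite exchange_big /=.
apply: le_trans (_ : \sum_(y : 'F_p) p%:R * Q ^+ (n - L.+1) <= _); last first.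
  by rewrite sumr_const card_Fp // -mulrA [leRHS]mulr_natl.
apply: ler_sum => y _; rewrite exchange_big /=.
apply: le_trans (_ : \sum_(t : 'F_p) Q ^+ (n - L.+1) <= _); last first.
  by rewrite sumr_const card_Fp // mulr_natl.
rewrite [leLHS]big_mkcond; apply: ler_sum => t _.
case: ifP => t0; last by rewrite exprn_ge0 // (le_trans ler01).
rewrite -(bigA_distr_bigA (fun j x => if j \in S then (x == y)%:R else
   expR (- (n%:R / 4 * sinsq (t * x))))) /=.
set X := \sum_x _ in leQ.
have X0 : 0 <= X by apply: sumr_ge0 => x _; apply: expR_ge0.
rewrite (eq_bigr (fun j => if j \in ~: S then X else 1)) => [|j _]; last first.
  rewrite inE; case: (j \in S) => /=.
    by rewrite (bigD1 y) //= eqxx big1 ?addr0 // => x /negPf ->.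
  by rewrite /X [RHS](reindex_inj (mulfI t0)).
rewrite -big_mkcond prodr_const.
apply: le_trans (_ : Q ^+ #|~: S| <= _).
  by rewrite lerXn2r ?nnegrE // (le_trans X0).
by rewrite ler_weXn2l // cardsCs finset.setCK card_ord leq_sub2l.
Qed.

End ZeroSumDensity.

(** * Summing the density bounds over all nonzero vectors *)

Section SumDensity.
Variables (R : realType) (p : nat) (p_pr : prime p) (n : nat) (n0 : (0 < n)%N).
Variables (a L k0 : nat).
Hypotheses (a0 : (0 < a)%N) (k00 : (0 < k0)%N) (np : (n <= p)%N) (ap : (2 * a <= p ^ 2)%N).
Hypothesis Ln : (16 * L < 9 * n)%N.
Local Notation Q := (65 * p%:R / Num.sqrt n%:R : R).

(** The four numeric hypotheses control, in order, sparse vectors, medium mass, large mass without a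
    frequent value, and large mass with one. The first sum is then at most [e], the other three at
    most 1; vectors of small mass add another [e]. *)
Lemma sum_density_le :
  (2^-1 : R) ^+ n * (n * p)%:R ^+ k0 <= 1 ->
  (n * p)%:R ^+ a * p%:R * (130 / Num.sqrt (2 * a)%:R) ^+ n <= 1 :> R ->
  p%:R * (130 * (p%:R / n%:R) * (96 * L%:R / n%:R + 32 / Num.sqrt n%:R)) ^+ n <= 1 :> R ->
  (128 / Num.sqrt k0%:R) ^+ n * (2 ^+ n * p%:R * p%:R * Q ^+ (n - L.+1)) <= 1 ->
  \sum_(v : {ffun 'I_n -> 'F_p} | [exists j, v j != 0]) density R v ^+ n <=
    2 * expR 1 + 3.
Proof.
move=> hS hB hC hD.
have [w wp w1] := exists_root_of_unity R[i] p_pr.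
have p0 : 0 < p%:R :> R by rewrite ltr0n prime_gt0.
have pn0 : p%:R != 0 :> R by rewrite gt_eqF.
have sn0 : 0 < Num.sqrt n%:R :> R by rewrite sqrtr_gt0 ltr0n.
have le_np : n%:R <= p%:R :> R by rewrite ler_nat.
pose A : R := expR 1 / p%:R ^+ n.
pose B (v : {ffun 'I_n -> 'F_p}) : R := (2 / p%:R) ^+ n * (n * p)%:R ^+ a *
     \sum_(t | t != 0) expR (- (a%:R / 2 * energy w v t)).
pose HC : R := p%:R / Num.sqrt n%:R * (96 * L%:R / n%:R + 32 / Num.sqrt n%:R).
pose C (v : {ffun 'I_n -> 'F_p}) : R := (2 * HC / p%:R) ^+ n *
     \sum_(t | t != 0) expR (- (n%:R / 4 * energy w v t)).
pose D (v : {ffun 'I_n -> 'F_p}) : R := level_bound w (128 / Num.sqrt k0%:R) L v.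
pose S (v : {ffun 'I_n -> 'F_p}) : R := sparse_bound R k0 v.
have HC0 : 0 <= HC.
  by rewrite !(mulr_ge0, addr_ge0, invr_ge0, sqrtr_ge0).
have A0 : 0 <= A by rewrite divr_ge0 ?expR_ge0 ?exprn_ge0.
have B0 v : 0 <= B v.
  rewrite !(mulr_ge0, exprn_ge0, invr_ge0) //.
  by apply: sumr_ge0 => t _; apply: expR_ge0.
have C0 v : 0 <= C v.
  apply: mulr_ge0; last by apply: sumr_ge0 => t _; apply: expR_ge0.
  by apply: exprn_ge0; apply: divr_ge0 => //; apply: mulr_ge0.
have D0 v : 0 <= D v.
  rewrite mulr_ge0 ?exprn_ge0 ?divr_ge0 ?sqrtr_ge0 //.
  apply: sumr_ge0 => T _; apply: sumr_ge0 => y _; apply: sumr_ge0 => t _.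
  by apply: prodr_ge0 => j _; case: ifP => // _; apply: expR_ge0.
have S0 v : 0 <= S v.
  rewrite mulr_ge0 ?mulr_ge0 ?exprn_ge0 ?invr_ge0 //.
  by apply: prodr_ge0 => j _; case: ifP => // _; rewrite invr_ge0.
(* The cases are tested in this order: mass at most [1 / n], mass at most 1, support at most [k0],
   no value taken more than [L] times, and the rest, where the support exceeds [k0] and
   [halasz_nonzero] applies to it. *)
have pointwise (v : {ffun 'I_n -> 'F_p}) : [exists j, v j != 0] ->
    density R v ^+ n <= A + B v + C v + D v + S v.
  case/existsP => j vj.
  have := B0 v; have := C0 v; have := D0 v; have := S0 v.
  have [F1|F1] := leP (fourier_mass w v) n%:R^-1.
    have := density_small_mass p_pr wp w1 F1; rewrite -/A; lra.
  have [F2|F2] := leP (fourier_mass w v) 1.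
    have := density_medium_mass p_pr wp w1 n0 a F1 F2; rewrite -/(B v); lra.
  have [supp|supp] := leqP #|[set i | v i != 0]| k0.
    have := density_sparse R p_pr n0 vj supp; rewrite -/(S v); lra.
  have [flat|] := boolP [forall i, #|[set j | v j == v i]| <= L]%N.
    have := halasz_flat p_pr wp w1 (v := v) (L := L).
    have flat' i : (#|[set j | v j == v i]| <= L)%N by exact: (forallP flat i).
    rewrite card_ord => /(_ n0 flat' Ln).
    move/(density_large_mass p_pr wp w1 F2); rewrite -/HC -/(C v); lra.
  case/forallPn => i; rewrite -ltnNge => Li.
  have suppN : [set i | v i != 0] != finset.set0.
    by rewrite -card_gt0; apply: leq_trans supp.
  have := halasz_nonzero p_pr wp w1 (v := v) suppN.
  have memS l : l \in [set i | v i != 0] -> v l != 0 by rewrite inE.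
  move=> /(_ memS) H; have {}H : \sum_(t | t != 0) expR (- (energy w v t / 4)) <=
      64 * p%:R / Num.sqrt k0%:R.
    apply: le_trans H _; rewrite ler_pM2l ?mulr_gt0 //.
    rewrite lef_pV2 ?posrE ?sqrtr_gt0 ?ltr0n //; last exact: leq_trans supp.
    by rewrite ler_wsqrtr // ler_nat ltnW.
  have := density_level p_pr wp w1 F2 H Li.
  rewrite (_ : 2 * _ / p%:R = 128 / Num.sqrt k0%:R) -/(D v); first by lra.
  by field; rewrite pn0 gt_eqF // sqrtr_gt0 ltr0n.
apply: le_trans (ler_sum _ pointwise) _.
apply: le_trans (_ : \sum_v (A + B v + C v + D v + S v) <= _).
  rewrite [leLHS]big_mkcond; apply: ler_sum => v _; case: ifP => // _.
  by rewrite !addr_ge0.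
rewrite !big_split /=.
have sumA : \sum_(v : {ffun 'I_n -> 'F_p}) A = expR 1.
  rewrite sumr_const card_ffun card_Fp // card_ord /A -[_ *+ _]mulr_natl natrX.
  by rewrite mulrC divfK // expf_neq0.
have moment (k : nat) (c : R) : (0 < k)%N -> (k <= p ^ 2)%N -> c = k%:R / 4 ->
    \sum_(v : {ffun 'I_n -> 'F_p}) \sum_(t | t != 0) expR (- (c * energy w v t)) <=
    p%:R * (65 * p%:R / Num.sqrt k%:R) ^+ n.
  move=> k_gt0 kp ->; rewrite (moment_factorization p_pr w) card_ord.
  have X0 : 0 <= \sum_(x : 'F_p) expR (- (k%:R / 4 * sinsq w x)).
    by apply: sumr_ge0 => x _; apply: expR_ge0.
  apply: ler_pM; rewrite ?ler_nat ?leq_pred // ?exprn_ge0 //.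
  rewrite lerXn2r ?nnegrE ?divr_ge0 ?mulr_ge0 ?sqrtr_ge0 //.
  exact: sum_exp_sinsq.
have sumB : \sum_v B v <= 1.
  rewrite -mulr_sumr; apply: le_trans hB.
  apply: le_trans (ler_wpM2l _ (moment (2 * a)%N _ _ _ _)) _ => //.
  - by rewrite !(mulr_ge0, exprn_ge0, invr_ge0).
  - by rewrite muln_gt0.
  - by rewrite natrM; field.
  rewrite le_eqVlt; apply/orP; left; apply/eqP.
  rewrite [130 / _](_ : _ = 2 / p%:R * (65 * p%:R / Num.sqrt (2 * a)%:R)).
    by rewrite [(2 / p%:R * _) ^+ n]exprMn; ring.
  by field; rewrite pn0 gt_eqF // sqrtr_gt0 ltr0n muln_gt0.
have np2 : (n <= p ^ 2)%N by apply: leq_trans np _; rewrite leq_pmulr // prime_gt0.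
have sumC : \sum_v C v <= 1.
  rewrite -mulr_sumr; apply: le_trans hC.
  apply: le_trans (ler_wpM2l _ (moment n _ _ _ _)) _ => //.
    by apply: exprn_ge0; apply: divr_ge0 => //; apply: mulr_ge0.
  rewrite le_eqVlt; apply/orP; left; apply/eqP; rewrite mulrCA -exprMn.
  congr (_ * _ ^+ _); rewrite /HC; set X := _ + _.
  rewrite (_ : p%:R / n%:R = p%:R / (Num.sqrt n%:R * Num.sqrt n%:R)).
    by field; rewrite pn0 gt_eqF.
  by rewrite -expr2 sqr_sqrtr.
have sumD : \sum_v D v <= 1.
  apply: le_trans hD; apply: sum_level_bound => //.
  - by rewrite !(mulr_ge0, invr_ge0, sqrtr_ge0).
  - rewrite ler_pdivlMr // mul1r; apply: le_trans (_ : n%:R <= _).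
      rewrite -ler_sqr ?nnegrE ?(ltW sn0) // sqr_sqrtr // -natrX ler_nat.
      by rewrite leq_pmulr.
    by apply: le_trans le_np _; rewrite ler_peMl // ler1n.
  - by move: Ln; clear; lia.
  exact: sum_exp_sinsq.
have sumS : \sum_v S v <= expR 1.
  apply: le_trans (sum_sparse_bound _ p_pr n0 k0) _.
  by rewrite ler_piMl ?expR_ge0.
rewrite sumA; lra.
Qed.
End SumDensity.

Lemma poly_le_exp2 (A E : nat) : exists b0, forall b, (b0 <= b)%N -> ((A * b) ^ E <= 2 ^ b)%N.
Proof.
case: E => [|E]; first by exists 0%N => b _; rewrite expn0 expn_gt0.
pose C := (A * E.+1)%N; exists (E.+1 * (8 * C + 2))%N => b hb.
pose m := (b %/ E.+1)%N; pose h := m./2.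
have mb : (m * E.+1 <= b)%N by apply: leq_trunc_div.
have bm : (b <= E.+1 * m.+1)%N by rewrite mulnC ltnW // ltn_ceil.
have hm : (8 * C + 2 <= m)%N by rewrite /m leq_divRL // mulnC.
apply: leq_trans (_ : (2 ^ m) ^ E.+1 <= _)%N; last by rewrite -expnM leq_exp2l.
rewrite leq_exp2r //; apply: leq_trans (_ : C * m.+1 <= _)%N.
  by rewrite /C -mulnA leq_mul2l bm orbT.
have h1 : (4 * C + 1 <= h)%N by rewrite /h; move: hm; clear; lia.
apply: leq_trans (_ : 2 ^ h * 2 ^ h <= _)%N; last first.
  by rewrite -expnD leq_exp2l // /h; clear; lia.
apply: leq_trans (_ : h * h <= _)%N; last by rewrite leq_mul // ltnW // ltn_expl.
apply: leq_trans (_ : (4 * C) * h <= _)%N; last first.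
  by rewrite leq_mul2r (leq_trans _ h1) ?orbT // leq_addr.
have : (m.+1 <= 4 * h)%N by move: h1; rewrite /h; clear; lia.
by rewrite [(4 * C)%N]mulnC -mulnA leq_mul2l => ->; rewrite orbT.
Qed.

(** Parameters: [a] is an absolute constant, [L] a small fixed proportion of [n], and [k0] of order
    [n / log n]. With [p / n] at most [G], all numeric hypotheses hold for large [n]. *)
Lemma sum_density_eventually (R : realType) (G : nat) : (0 < G)%N ->
  exists n1, forall n p, (n1 <= n)%N -> prime p -> (n <= p <= G * n)%N ->
  \sum_(v : {ffun 'I_n -> 'F_p} | [exists j, v j != 0]) density R v ^+ n <=
    2 * expR 1 + 3.
Proof.
(* This makes [sqrt (2 * a)] equal to [2 ^ 10], so [130 / sqrt (2 * a)] is below 1/2 and the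
   remaining polynomial factor is beaten by [2 ^ n]. *)
move=> G0; have [a aE] : exists a, (2 * a = (2 ^ 10) ^ 2)%N.
  by exists (2 ^ 19)%N; rewrite -expnS -expnM.
(* [c1 = 4 * 130 * 32] and [c2 = 4 * 130 * 96]: each of the two terms in the base of the flat bound
   becomes at most 1/4. *)
have [c1 c1E] : exists c : nat, c%:R = 160 * 104 :> R.
  by exists (160 * 104)%N; rewrite natrM.
have [c2 c2E c2_16] : exists2 c : nat, c%:R = 480 * 104 :> R & (16 <= c)%N.
  by exists (480 * 104)%N; rewrite ?natrM //; apply: leq_trans (leq_pmulr _ _).
(* [c3 = 128 * 4 * 65] collects the constants of the frequent-value bound, the 4 coming from
   [2 ^ n * p * p <= 4 ^ n]. *)
have [c3 c3E] : exists c : nat, c%:R = 320 * 104 :> R.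
  by exists (320 * 104)%N; rewrite natrM.
have a0 : (0 < a)%N by move: aE; case: (a) => // ; rewrite muln0 => /esym/eqP; rewrite !expn_eq0.
have c3_gt0 : (0 < c3)%N by rewrite -(ltr_nat R) c3E mulr_gt0.
have D16 : (16 <= c2 * G)%N by apply: leq_trans c2_16 _; rewrite leq_pmulr.
have DE : (c2 * G)%:R = 480 * 104 * G%:R :> R by rewrite natrM c2E.
have KE : (c3 * G)%:R = 320 * 104 * G%:R :> R by rewrite natrM c3E.
have K_gt0 : (0 < c3 * G)%N by rewrite muln_gt0 c3_gt0.
move: (c2 * G)%N (c3 * G)%N D16 DE KE K_gt0 => D K D16 DE KE K_gt0.
have D0 : (0 < D)%N by apply: leq_trans D16.
have [b0 hb0] := poly_le_exp2 (6 * K ^ 2 + 3 * a.+1) D.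
exists (2 ^ (b0 + G + 2) + (c1 * G) ^ 2 + 2 * a)%N => n p nn1 pp /andP[np pG].
have nb : (2 ^ (b0 + G + 2) <= n)%N.
  by apply: leq_trans nn1; exact: leq_trans (leq_addr _ _) (leq_addr _ _).
have nG : ((c1 * G) ^ 2 <= n)%N.
  by apply: leq_trans nn1; exact: leq_trans (leq_addl _ _) (leq_addr _ _).
have na : (2 * a <= n)%N by apply: leq_trans nn1; exact: leq_addl.
clear nn1; have n0 : (0 < n)%N by apply: leq_trans nb; rewrite expn_gt0.
pose b := trunc_log 2 n.
have /andP[b1 b2] := trunc_log_bounds (isT : (1 < 2)%N) n0; rewrite -/b in b1 b2.
have bb : (b0 + G + 2 <= b)%N.
  exact: trunc_log_max.
have b_gt0 : (0 < b)%N by move: bb; clear; lia.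
have polyb : (((6 * K ^ 2 + 3 * a.+1) * b) ^ D <= n)%N.
  by apply: leq_trans b1; apply: hb0; move: bb; clear; lia.
have polyb1 : ((6 * K ^ 2 + 3 * a.+1) * b <= n)%N.
  by apply: leq_trans polyb; rewrite -{1}[(_ * b)%N]expn1 leq_pexp2l // muln_gt0 b_gt0 addn_gt0 orbT.
have G2 : (n * p <= 2 ^ (3 * b))%N.
  apply: leq_trans (_ : 2 ^ G * (2 ^ b.+1 * 2 ^ b.+1) <= _)%N.
    apply: leq_trans (_ : n * (G * n) <= _)%N; first by rewrite leq_mul2l pG orbT.
    rewrite [(n * (G * n))%N]mulnCA; apply: leq_mul; first exact/ltnW/ltn_expl.
    by apply: leq_mul; apply: ltnW.
  by rewrite -!expnD leq_exp2l //; move: bb; clear; lia.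
have p2 : (p <= 2 ^ (3 * b))%N by apply: leq_trans G2; rewrite leq_pmull.
have b3 : (3 * b * a.+1 <= n)%N.
  apply: leq_trans polyb1; rewrite mulnDl; clear; lia.
have pn2 : (p <= 2 ^ n)%N.
  apply: leq_trans p2 _; rewrite leq_exp2l //; apply: leq_trans b3.
  by rewrite leq_pmulr.
(* As [n * p <= 2 ^ (3 * b)], this [k0] ensures [(n * p) ^ k0 <= 2 ^ n], which is the sparse
   hypothesis. *)
pose L := (n %/ D)%N; pose k0 := (n %/ (3 * b))%N.
have k0n : (3 * b * k0 <= n)%N by rewrite mulnC leq_trunc_div.
have b3n : (3 * b <= n)%N by apply: leq_trans b3; rewrite leq_pmulr.
have b30 : (0 < 3 * b)%N by rewrite muln_gt0.
have k00 : (0 < k0)%N by rewrite /k0 divn_gt0.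
have k0n' : (n <= 6 * b * k0)%N.
  apply: leq_trans (ltnW (ltn_ceil n b30)) _; rewrite -/k0.
  apply: leq_trans (_ : (2 * k0) * (3 * b) <= _)%N.
    rewrite leq_mul2r; apply/orP; right; move: k00; move: (k0) => x; clear; lia.
  by rewrite [leqLHS]mulnACA [(k0 * b)%N]mulnC mulnA.
have LD : (L * D <= n)%N by apply: leq_trunc_div.
have nL : (n <= L.+1 * D)%N by apply/ltnW/ltn_ceil.
have nR : 0 < n%:R :> R by rewrite ltr0n.
have pGR : p%:R / n%:R <= G%:R :> R by rewrite ler_pdivrMr // -natrM ler_nat.
set s : R := Num.sqrt n%:R.
have s0 : 0 < s by rewrite sqrtr_gt0.
have s2 : s ^+ 2 = n%:R by rewrite sqr_sqrtr // ltW.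
have sG : 160 * 104 * G%:R <= s.
  rewrite -ler_sqr ?nnegrE ?mulr_ge0 ?(ltW s0) // s2.
  by rewrite -c1E -natrM -natrX ler_nat.
have GR : 1 <= G%:R :> R by rewrite ler1n.
apply: (@sum_density_le R p pp n n0 a L k0) => //.
- apply: leq_trans na _; by apply: leq_trans np _; rewrite leq_pmulr // prime_gt0.
- apply: leq_ltn_trans (_ : L * D < _)%N.
    by rewrite mulnC leq_mul2l D16 orbT.
  by apply: leq_ltn_trans LD _; rewrite ltn_Pmull.
- rewrite exprVn mulrC ler_pdivrMr ?exprn_gt0 // mul1r -!natrX ler_nat.
  apply: leq_trans (_ : (2 ^ (3 * b)) ^ k0 <= _)%N; first by rewrite leq_exp2r.
  by rewrite -expnM leq_exp2l.
- apply: le_trans (_ : 2 ^+ n * (2^-1) ^+ n <= _); last first.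
    by rewrite -exprMn mulfV ?pnatr_eq0 // expr1n.
  apply: ler_pM.
  - by rewrite mulr_ge0 // exprn_ge0.
  - by rewrite exprn_ge0 // divr_ge0 // sqrtr_ge0.
  - rewrite -!natrX -natrM ler_nat.
    apply: leq_trans (_ : (2 ^ (3 * b)) ^ a * 2 ^ (3 * b) <= _)%N.
      by apply: leq_mul => //; rewrite leq_exp2r // expn_gt0.
    by rewrite -expnM -expnD leq_exp2l //; move: b3; rewrite mulnS addnC.
  rewrite lerXn2r ?nnegrE ?divr_ge0 ?invr_ge0 ?sqrtr_ge0 //.
  have -> : (2 * a)%:R = (2 ^+ 10) ^+ 2 :> R.
    by rewrite aE !natrX.
  rewrite sqrtr_sqr ger0_norm ?exprn_ge0 // ler_pdivrMr ?exprn_gt0 //.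
  by rewrite -natrX; lra.
- apply: le_trans (_ : 2 ^+ n * (2^-1) ^+ n <= _); last first.
    by rewrite -exprMn mulfV ?pnatr_eq0 // expr1n.
  have sV : s^-1 * (160 * 104 * G%:R) <= 1 by rewrite mulrC ler_pdivrMr // mul1r.
  have LV : L%:R / n%:R * (480 * 104 * G%:R) <= 1 :> R.
    by rewrite -DE mulrAC ler_pdivrMr // mul1r -natrM ler_nat.
  have X0 : 0 <= 96 * L%:R / n%:R + 32 / s.
    by rewrite !(addr_ge0, mulr_ge0, invr_ge0) // ltW.
  apply: ler_pM => //.
  - by apply: exprn_ge0; rewrite !mulr_ge0 // invr_ge0.
  - by rewrite -natrX ler_nat.
  rewrite lerXn2r ?nnegrE ?invr_ge0 //; first by rewrite !mulr_ge0 // invr_ge0.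
  apply: le_trans (_ : 130 * G%:R * (96 * L%:R / n%:R + 32 / s) <= _).
    by rewrite ler_wpM2r // ler_wpM2l.
  rewrite -mulrA; lra.
(* Replacing [sqrt k0] by [s / r] and [p] by [G * n], all powers of [s] cancel except [s ^ (L + 1)]
   in the denominator. It wins because [(K * r) ^ D <= s] and [n <= (L + 1) * D]. *)
- pose r : R := Num.sqrt (6 * b)%:R.
  have r0 : 0 < r by rewrite sqrtr_gt0 ltr0n muln_gt0.
  have r1 : 1 <= r by rewrite -[leLHS]sqrtr1 ler_wsqrtr // ler1n muln_gt0.
  have sk0 : 0 < Num.sqrt k0%:R :> R by rewrite sqrtr_gt0 ltr0n.
  have kV : 128 / Num.sqrt k0%:R <= 128 * r / s.
    rewrite ler_pdivlMr // mulrAC ler_pdivrMr // -mulrA ler_pM2l // /s /r.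
    by rewrite -sqrtrM // ler_wsqrtr // -natrM ler_nat.
  have QV : 65 * p%:R / s <= 65 * G%:R * s.
    rewrite ler_pdivrMr // -!mulrA ler_pM2l // -expr2 s2 -natrM ler_nat //.
  have KrD : (K%:R * r) ^+ D <= s.
    rewrite -ler_sqr ?nnegrE ?exprn_ge0 ?mulr_ge0 ?(ltW s0) ?(ltW r0) //.
    rewrite s2 exprAC [(K%:R * r) ^+ 2]exprMn sqr_sqrtr // -natrX -natrM -natrX ler_nat.
    apply: leq_trans polyb; rewrite leq_exp2r // mulnA [(K ^ 2 * _)%N]mulnC.
    by rewrite leq_mul2r leq_addr orbT.
  have Kr1 : 1 <= K%:R * r.
    by rewrite mulr_ege1 // ler1n.
  have ln : (L.+1 <= n)%N.
    by rewrite /L; apply: ltn_Pdiv => //; apply: leq_trans D16.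
  apply: le_trans (_ : (128 * r / s) ^+ n * (4 ^+ n * (65 * G%:R * s) ^+ (n - L.+1)) <= _).
    have Q0 : 0 <= 65 * p%:R / s by rewrite !mulr_ge0 ?invr_ge0 ?(ltW s0).
    apply: ler_pM.
    - by rewrite exprn_ge0 // divr_ge0 // ltW.
    - by rewrite mulr_ge0 ?exprn_ge0 // !mulr_ge0 ?exprn_ge0.
    - by rewrite lerXn2r ?nnegrE ?divr_ge0 ?mulr_ge0 ?(ltW r0) ?(ltW s0) ?(ltW sk0).
    apply: ler_pM.
    - by rewrite !mulr_ge0 ?exprn_ge0.
    - by rewrite exprn_ge0.
    - rewrite (_ : 4 = 2 * 2 :> R); last by rewrite -natrM.
      rewrite exprMn -mulrA ler_pM2l ?exprn_gt0 // -natrM -natrX ler_nat.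
      apply: leq_trans (leq_mul p2 p2) _; rewrite -expnD leq_exp2l //.
      by apply: leq_trans b3; rewrite addnn -muln2 leq_mul2l ltnS a0 orbT.
    - by rewrite lerXn2r ?nnegrE // !mulr_ge0 ?(ltW s0).
  apply: le_trans (_ : (K%:R * r) ^+ n / s ^+ L.+1 <= _); last first.
    rewrite ler_pdivrMr ?exprn_gt0 // mul1r.
    apply: le_trans (_ : (K%:R * r) ^+ (L.+1 * D) <= _).
      by rewrite ler_weXn2l.
    rewrite mulnC exprM lerXn2r ?nnegrE ?exprn_ge0 ?mulr_ge0 ?(ltW r0) ?(ltW s0) //.
  have -> : (65 * G%:R * s) ^+ (n - L.+1) = (65 * G%:R) ^+ (n - L.+1) * (s ^+ n / s ^+ L.+1).
    by rewrite exprMn -[in s ^+ n](subnK ln) exprD mulfK // expf_neq0 // gt_eqF.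
  apply: le_trans (_ : (128 * r / s) ^+ n * (4 ^+ n * ((65 * G%:R) ^+ n * (s ^+ n / s ^+ L.+1))) <= _).
    rewrite ler_wpM2l ?exprn_ge0 ?divr_ge0 ?mulr_ge0 ?(ltW r0) ?(ltW s0) //.
    rewrite ler_wpM2l ?exprn_ge0 // ler_wpM2r ?divr_ge0 ?exprn_ge0 ?(ltW s0) //.
    by rewrite ler_weXn2l ?leq_subr //; lra.
  rewrite le_eqVlt; apply/orP; left; apply/eqP.
  rewrite [128 * r / s]mulrC !mulrA -!exprMn.
  congr (_ ^+ _ / _); rewrite KE.
  by field; rewrite gt_eqF.
Qed.

(** * Singular 0/1 matrices and circuits *)

Definition incidence_mx (K : pzRingType) (n : nat) (f : {ffun 'I_n -> {set 'I_n}}) : 'M[K]_n :=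
  \matrix_(i, j) (j \in f i)%:R.

Definition singular_families (R : realType) n : {set {ffun 'I_n -> {set 'I_n}}} :=
  [set f | \det (incidence_mx R f) == 0].

Lemma det_incidence_intr (K : comPzRingType) n (f : {ffun 'I_n -> {set 'I_n}}) :
  \det (incidence_mx K f) = (\det (incidence_mx int f))%:~R.
Proof.
rewrite -(det_map_mx (intmul (1 : K))); congr (\det _).
by apply/matrixP => i j; rewrite !mxE rmorph_nat.
Qed.

(** The determinant is an integer; vanishing over [R], it also vanishes modulo [p], which yields a
    kernel vector over [F_p]. *)
Lemma singular_family_zero_sums (R : realType) (p n : nat) (f : {ffun 'I_n -> {set 'I_n}}) :
  prime p -> f \in singular_families R n ->
  exists v : {ffun 'I_n -> 'F_p}, [exists j, v j != 0] && [forall i, f i \in zero_sums v].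
Proof.
move=> pp; rewrite inE det_incidence_intr intr_eq0 => /eqP det0.
have : \det (incidence_mx 'F_p f)^T == 0 by rewrite det_tr det_incidence_intr det0.
case/det0P => u u0 uM; exists [ffun j => u 0 j]; apply/andP; split.
  move: u0; apply: contraNT => /existsPn H; apply/eqP/rowP => j.
  by have := H j; rewrite ffunE negbK mxE => /eqP.
apply/forallP => i; rewrite inE; apply/eqP.
move/rowP/(_ i): uM; rewrite !mxE => H; rewrite -[RHS]H big_mkcond.
apply: eq_bigr => j _; rewrite !mxE ffunE.
by case: ifP => _; rewrite ?mulr1 ?mulr0.
Qed.

(** Double counting of pairs [(f, v)] with [v] in the kernel of [f]: a singular [f] is hit by the
    [p - 1] nonzero multiples of one kernel vector, while [v] admits [#|zero_sums v| ^ n]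
    families. *)
Lemma card_singular_families (R : realType) (p n : nat) : prime p ->
  p.-1%:R * #|singular_families R n|%:R <=
  (2 ^ (n * n))%:R * \sum_(v : {ffun 'I_n -> 'F_p} | [exists j, v j != 0]) density R v ^+ n.
Proof.
move=> pp.
pose nz (v : {ffun 'I_n -> 'F_p}) := [exists j, v j != 0].
have -> : (2 ^ (n * n))%:R * \sum_(v | nz v) density R v ^+ n =
    (\sum_(v | nz v) #|zero_sums v| ^ n)%:R :> R.
  rewrite natr_sum mulr_sumr; apply: eq_bigr => v _.
  rewrite /density expr_div_n expnM !natrX mulrC divfK //.
  by rewrite !expf_neq0 // pnatr_eq0.
rewrite -natrM ler_nat.
have -> : (\sum_(v | nz v) #|zero_sums v| ^ n =
    \sum_(f : {ffun 'I_n -> {set 'I_n}})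
      #|[set v | nz v && [forall i, f i \in zero_sums v]]|)%N.
  under [RHS]eq_bigr do rewrite -sum1dep_card big_mkcondr.
  rewrite exchange_big /=; apply: eq_bigr => v _.
  rewrite -[X in (_ ^ X)%N]card_ord -card_ffun_on -big_mkcond sum1dep_card.
  by apply: eq_card => f; rewrite !inE.
rewrite mulnC -sum_nat_const big_mkcond; apply: leq_sum => f _; case: ifP => // fS.
have [v /andP[/existsP[j vj] fv]] := singular_family_zero_sums pp fS.
have <- : #|[set [ffun i => t * v i] | t in [set t : 'F_p | t != 0]]| = p.-1.
  rewrite card_in_imset => [|t u _ _ /ffunP/(_ j)]; last first.
    by rewrite !ffunE; apply: mulIf.
  by rewrite cardsE cardC1 card_Fp.
apply: subset_leq_card; apply/subsetP => _ /imsetP[t t0 ->]; rewrite inE in t0.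
rewrite inE; apply/andP; split.
  by apply/existsP; exists j; rewrite ffunE mulf_neq0.
apply/forallP => i; have := forallP fv i; rewrite !inE => /eqP H.
by under eq_bigr do rewrite ffunE; rewrite -mulr_sumr H mulr0.
Qed.

Section Circuits.
Variables (R : realType) (n : nat).
Implicit Types C D : {set {set 'I_n}}.

Lemma lin_dependentS D C : D \subset C -> lin_dependent R D -> lin_dependent R C.
Proof.
move=> DC; apply: contra => fr.
have pE : perm_eq (enum C) (enum D ++ enum (C :\: D)).
  apply: uniq_perm; rewrite ?enum_uniq //.
    rewrite cat_uniq !enum_uniq /= andbT; apply/hasPn => A.
    by rewrite !mem_enum inE => /andP[].
  move=> A; rewrite mem_cat !mem_enum inE; case: (boolP (A \in D)) => //=.
  by move/(subsetP DC) ->.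
have := perm_map (charvec R (n:=n)) pE; move/perm_free => E.
by move: fr; rewrite E map_cat => /catl_free.
Qed.

Lemma lin_dependent_card C : (n < #|C|)%N -> lin_dependent R C.
Proof.
move=> nC; apply/negP; rewrite /free size_map -cardE => /eqP H.
have := dimvS (subvf <<[seq charvec R A | A <- enum C]>>).
by rewrite H dimvf /dim /= mul1n leqNgt nC.
Qed.

Definition dependent_sets : {set {set {set 'I_n}}} :=
  [set D in subcollections n n | lin_dependent R D].

Lemma dependent_family_singular (f : {ffun 'I_n -> {set 'I_n}}) :
  injective f -> lin_dependent R [set f i | i : 'I_n] -> f \in singular_families R n.
Proof.
move=> f_inj; rewrite inE; apply: contraTT => det0; rewrite negbK.
have pE : perm_eq (enum [set f i | i : 'I_n]) [seq f i | i <- enum 'I_n].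
  apply: uniq_perm => [||A]; first exact: enum_uniq.
    by rewrite map_inj_uniq //; exact: enum_uniq.
  rewrite mem_enum; apply/imsetP/mapP => -[i _ ->]; exists i => //.
  by rewrite mem_enum.
have := perm_map (charvec R (n:=n)) pE; move/perm_free => ->.
have -> : [seq charvec R A | A <- [seq f i | i <- enum 'I_n]] =
    [tuple charvec R (f i) | i < n].
  by rewrite -map_comp.
apply/freeP => k sum0.
have : (\row_i k i) *m incidence_mx R f = 0.
  apply/rowP => j; move/rowP/(_ j): sum0; rewrite !mxE summxE => sum0.
  rewrite -[RHS]sum0; apply: eq_bigr => i _.
  by rewrite -tnth_nth tnth_mktuple !mxE.
have U : incidence_mx R f \in unitmx by rewrite unitmxE unitfE.
move/(congr1 (mulmx^~ (invmx (incidence_mx R f)))); rewrite mulmxK // mul0mx.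
by move=> /rowP H i; have := H i; rewrite !mxE.
Qed.

(** Each dependent [n]-set has [n!] injective enumerations, all singular, and an enumeration
    determines its set. *)
Lemma card_dependent_sets : (n`! * #|dependent_sets| <= #|singular_families R n|)%N.
Proof.
pose F (D : {set {set 'I_n}}) := [set f : {ffun 'I_n -> {set 'I_n}} in ffun_on (mem D) | injectiveb f].
have imF D f : #|D| = n -> f \in F D -> D = [set f i | i : 'I_n].
  move=> cD; rewrite inE => /andP[/ffun_onP fD /injectiveP fi].
  apply/esym/eqP; rewrite eqEcard card_imset // card_ord cD leqnn andbT.
  by apply/subsetP => _ /imsetP[i _ ->]; apply: fD.
rewrite mulnC -sum_nat_const.
apply: (@leq_trans (\sum_(D in dependent_sets) #|F D|)%N).
  apply: leq_sum => D; rewrite !inE => /andP[/andP[_ /eqP cD] _].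
  by rewrite card_inj_ffuns_on cD card_ord ffactnn.
under eq_bigr do rewrite -sum1_card.
rewrite (exchange_big_dep predT) //= -sum1_card [leqRHS]big_mkcond.
apply: leq_sum => f _; rewrite sum1dep_card.
set E := [set _ | _].
have [->|/set0Pn[D]] := eqVneq E set0; first by rewrite cards0.
rewrite inE => /andP[Ddep DF].
have cD D' : D' \in dependent_sets -> #|D'| = n.
  by rewrite !inE => /andP[/andP[_ /eqP]].
have [f_inj fD] : injective f /\ D = [set f i | i : 'I_n].
  split; last exact: imF (cD _ Ddep) DF.
  by move: DF; rewrite inE => /andP[_ /injectiveP].
have -> : f \in singular_families R n.
  apply: dependent_family_singular => //; rewrite -fD.
  by move: Ddep; rewrite inE => /andP[].
suff -> : E = [set D] by rewrite cards1.
apply/setP => D'; rewrite !in_set1 in_set; apply/andP/eqP => [[D'dep D'F]|->] //.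
by rewrite fD; apply: imF D'F; apply: cD.
Qed.

End Circuits.

(** * Counting circuits and non-circuits *)

Section CircuitCount.
Variables (R : realType) (n : nat).
Implicit Types C D : {set {set 'I_n}}.

Lemma circuitP C : reflect
  [/\ C \subset normals n, lin_dependent R C &
      forall D, D \proper C -> ~~ lin_dependent R D] (circuit R C).
Proof.
apply: (iffP minsetP) => [[/andP[CN Cd] Cmin]|[CN Cd Cmin]].
  split=> // D /andP[DC CD]; apply/negP => Dd; move: CD.
  by rewrite (Cmin D) ?subxx // Dd (subset_trans DC).
split=> [|D /andP[_ Dd] DC]; first by rewrite CN.
apply/eqP; apply: contraTT Dd => neq; apply: Cmin.
by rewrite properEneq neq.
Qed.

Lemma circuit_card C : circuit R C -> (#|C| <= n.+1)%N.
Proof.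
case/circuitP=> _ _ Cmin; rewrite leqNgt; apply/negP => nC.
have /card_gt0P[A CA] : (0 < #|C|)%N by apply: leq_trans nC.
have := Cmin (C :\ A) (properD1 CA); rewrite lin_dependent_card //.
by move: nC; rewrite (cardsD1 A C) CA ltnS.
Qed.

Lemma card_normals : #|normals n| = (2 ^ n - 1)%N.
Proof.
have -> : normals n = [set~ finset.set0].
  by apply/setP => S; rewrite !inE.
rewrite cardsC1 -cardsT -powersetT card_powerset cardsT card_ord.
by rewrite subn1.
Qed.

Lemma card_subcollections m : #|subcollections n m| = 'C(2 ^ n - 1, m).
Proof. by rewrite /subcollections cards_draws card_normals. Qed.

Definition noncircuits : {set {set {set 'I_n}}} :=
  [set C in subcollections n n.+1 | ~~ circuit R C].

Lemma kappa_size_noncircuits :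
  (kappa_size R n n.+1 + #|noncircuits|)%N = 'C(2 ^ n - 1, n.+1).
Proof.
rewrite -card_subcollections -[RHS](cardsID [set C | circuit R C]); congr (_ + _)%N.
  apply: eq_card => C; rewrite !inE andbC; case: (circuitP C) => [[CN _ _]|_].
    by rewrite CN andbT.
  by rewrite !andbF.
by apply: eq_card => C; rewrite !inE andbC.
Qed.

(** A set of [n + 1] normals is always dependent, so failing to be a circuit means having a
    dependent proper subset. This subset omits some [A], and removing [A] alone leaves a dependent
    [n]-set. *)
Lemma card_noncircuits : (#|noncircuits| <= 2 ^ n * #|dependent_sets R n|)%N.
Proof.
have sub : noncircuits \subset
    [set A |: D | A in [set: {set 'I_n}], D in dependent_sets R n].
  apply/subsetP => C; rewrite !inE => /andP[/andP[CN /eqP cC]].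
  have Cd : lin_dependent R C by rewrite lin_dependent_card // cC.
  have [/existsP[D /andP[DC Dd]]|noD] :=
    boolP [exists D : {set {set 'I_n}}, (D \proper C) && lin_dependent R D]; last first.
    case/negP; apply/circuitP; split=> // D DC; apply/negP => Dd.
    by move/existsP: noD; apply; exists D; rewrite DC.
  move=> _; case/properP: DC => DC [A CA AD].
  apply/imset2P; exists A (C :\ A); rewrite ?inE ?setD1K //.
  rewrite (subset_trans (subD1set _ _) CN) /=; apply/andP; split.
    by move: cC; rewrite (cardsD1 A C) CA add1n => -[->].
  apply: lin_dependentS Dd; apply/subsetP => B DB.
  by rewrite !inE (subsetP DC) // andbT; apply: contraNneq AD => <-.
apply: leq_trans (subset_leq_card sub) _; rewrite curry_imset2X.
apply: leq_trans (leq_imset_card _ _) _; rewrite cardsX.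
by rewrite leq_mul2r -powersetT card_powerset cardsT card_ord leqnn orbT.
Qed.

Lemma kappa_le : (kappa R n <= kappa_size R n n.+1 + \sum_(m < n.+1) 'C(2 ^ n - 1, m))%N.
Proof.
rewrite /kappa -[leqLHS](cardsID [set C : {set {set 'I_n}} | #|C| == n.+1]); apply: leq_add.
  by apply: subset_leq_card; apply/subsetP => C; rewrite !inE.
apply: leq_trans (_ : #|\bigcup_(m < n.+1) subcollections n m| <= _)%N.
  apply: subset_leq_card; apply/subsetP => C; rewrite !inE => /andP[nC Cc].
  have Cle : (#|C| < n.+1)%N by rewrite ltn_neqAle nC circuit_card.
  apply/bigcupP; exists (Ordinal Cle) => //; rewrite inE eqxx andbT.
  by case/circuitP: Cc.
apply: leq_trans (_ : \sum_(m < n.+1) #|subcollections n m| <= _)%N; last first.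
  by apply: leq_sum => m _; rewrite card_subcollections.
elim/big_rec2: _ => [|m x S _ IH]; first by rewrite cards0.
by apply: leq_trans (leq_card_setU _ _) _; rewrite leq_add2l.
Qed.

Lemma kappa_size_le : (kappa_size R n n.+1 <= kappa R n)%N.
Proof. by apply: subset_leq_card; apply/subsetP => C; rewrite !inE => /andP[]. Qed.

End CircuitCount.

Lemma leq_bin_succ N m : (m.*2 < N)%N -> ('C(N, m) <= 'C(N, m.+1))%N.
Proof.
move=> mN; rewrite -(leq_pmul2l (ltn0Sn m)) mul_bin_left leq_mul2r.
by apply/orP; right; move: mN; clear; lia.
Qed.

Lemma sum_bin_le N n : (n.*2 < N)%N ->
  (\sum_(m < n.+1) 'C(N, m) <= n.+1 * 'C(N, n))%N.
Proof.
move=> nN; rewrite -[n.+1 in X in (_ <= X)%N]card_ord -sum_nat_const.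
apply: leq_sum => m _; have := ltn_ord m; rewrite ltnS; move: (nat_of_ord m) => {}m.
move=> mn; elim: n mn nN => [|n IH]; first by rewrite leqn0 => /eqP ->.
rewrite leq_eqVlt => /orP[/eqP -> //|mn nN].
have nN' : (n.*2 < N)%N by move: nN; clear; lia.
by apply: leq_trans (IH mn nN') _; apply: leq_bin_succ.
Qed.

(** * Asymptotics *)

(** The ratio is the product of [1 - (i + 1) / M] over [i < m], each factor losing at most [m / M].
    The upper bound 1 is carried along because the induction step needs it. *)
Lemma ffact_ratio_ge (R : realType) (M m : nat) : (0 < M)%N ->
  1 - (m ^ 2)%:R / M%:R <= (M.-1 ^_ m)%:R / M%:R ^+ m :> R.
Proof.
move=> M0; have MR : 0 < M%:R :> R by rewrite ltr0n.
have [mM|Mm] := leqP m M; last first.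
  apply: le_trans (_ : 0 <= _); last by rewrite divr_ge0 ?exprn_ge0.
  rewrite subr_le0 ler_pdivlMr // mul1r ler_nat expnS expn1.
  by apply: leq_trans (ltnW Mm) _; rewrite leq_pmulr // (leq_trans M0 (ltnW Mm)).
suff H i : (i <= m)%N -> 1 - i%:R * m%:R / M%:R <= (M.-1 ^_ i)%:R / M%:R ^+ i :> R
    /\ (M.-1 ^_ i)%:R / M%:R ^+ i <= 1 :> R.
  by have [] := H m (leqnn m); rewrite -natrM mulnn.
elim: i => [|i IH] im; first by rewrite !mul0r subr0 ffactn0 expr0 divr1.
have [IH1 IH2] := IH (ltnW im).
set q := (_ ^_ i)%:R / _ in IH1 IH2.
have q0 : 0 <= q by rewrite divr_ge0 ?exprn_ge0.
have E : (M.-1 ^_ i.+1)%:R / M%:R ^+ i.+1 = q * (1 - i.+1%:R / M%:R) :> R.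
  rewrite ffactnSr natrM exprS /q natrB; last by move: im mM M0; clear; lia.
  rewrite -[in i.+1%:R]natr1 -subn1 natrB //.
  by field; rewrite ?expf_neq0 // gt_eqF.
have u1 : i.+1%:R / M%:R <= m%:R / M%:R :> R by rewrite ler_pM2r ?invr_gt0 // ler_nat.
have u0 : 0 <= i.+1%:R / M%:R :> R by rewrite divr_ge0.
rewrite E -[in X in 1 - X]natr1 -mulrA mulrDl mul1r mulrA.
move: (i.+1%:R / _) (m%:R / _) u0 u1 IH1 => u t u0 u1 IH1; split; last by nra.
by move: IH1; rewrite -mulrA; nra.
Qed.

Section Limits.
Variable R : realType.
Implicit Types u v : nat -> R.
Local Open Scope classical_set_scope.

Lemma cvg_ratio1 u v : u n @[n --> \oo] --> (1 : R) -> v n @[n --> \oo] --> (1 : R) ->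
  u n / v n @[n --> \oo] --> (1 : R).
Proof.
move=> u1 v1; rewrite -[X in _ --> X]divr1.
by apply: cvgM => //; apply: cvgV => //; rewrite oner_neq0.
Qed.

Lemma cvg_squares_over_exp2 : (n.+1 ^ 2)%:R / (2 ^ n)%:R @[n --> \oo] --> (0 : R).
Proof.
apply: (@squeeze_cvgr _ _ _ _ (fun=> 0) (@harmonic R)); last 2 first.
- exact: cvg_cst.
- exact: cvg_harmonic.
have [b0 hb] := poly_le_exp2 2 3.
exists b0.+1 => // n /= bn; rewrite divr_ge0 //=.
rewrite ler_pdivrMr ?ltr0n ?expn_gt0 // /harmonic /= mulrC ler_pdivlMr ?ltr0n //.
rewrite -natrM ler_nat -expnSr; apply: leq_trans (hb n (ltnW bn)).
by rewrite leq_exp2r // mul2n -addnn -addn1 leq_add2l; apply: leq_trans bn.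
Qed.

Definition main_term (n : nat) : R := 2%:R ^+ (n * n.+1)%N / (n.+1`!)%:R.

Lemma main_term_gt0 n : 0 < main_term n.
Proof. by rewrite divr_gt0 ?exprn_gt0 // ltr0n fact_gt0. Qed.

Lemma bin_over_main_term n :
  ('C(2 ^ n - 1, n.+1))%:R / main_term n = ((2 ^ n).-1 ^_ n.+1)%:R / (2 ^ n)%:R ^+ n.+1.
Proof.
by rewrite /main_term invf_div mulrA -natrM bin_ffact subn1 exprM natrX.
Qed.

Lemma ffact_le_exp N m : (N ^_ m <= N ^ m)%N.
Proof.
elim: m => // m IH; rewrite ffactnSr expnSr.
by apply: leq_mul => //; apply: leq_subr.
Qed.

Lemma cvg_bin_over_main_term : ('C(2 ^ n - 1, n.+1))%:R / main_term n @[n --> \oo] --> (1 : R).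
Proof.
apply: (@squeeze_cvgr _ _ _ _
    (fun n : nat => 1 - (n.+1 ^ 2)%:R / (2 ^ n)%:R) (fun=> 1)); last 2 first.
- rewrite -[X in _ --> X]subr0.
  by apply: cvgB; [exact: cvg_cst | exact: cvg_squares_over_exp2].
- exact: cvg_cst.
near=> n; rewrite bin_over_main_term ffact_ratio_ge ?expn_gt0 //=.
rewrite ler_pdivrMr ?exprn_gt0 ?ltr0n ?expn_gt0 // mul1r -natrX ler_nat.
by apply: leq_trans (ffact_le_exp _ _) _; rewrite leq_exp2r // leq_pred.
Unshelve. all: by end_near. Qed.

(** This chains [card_noncircuits], [card_dependent_sets] and [card_singular_families]; the factor
    [n + 1] is the quotient of the factorials of [n + 1] and [n]. *)
Lemma noncircuits_over_main_term (K : R) (n p : nat) : prime p -> (0 < n)%N -> 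
  \sum_(v : {ffun 'I_n -> 'F_p} | [exists j, v j != 0%R]) density R v ^+ n <= K ->
  #|noncircuits R n|%:R / main_term n <= n.+1%:R * K / p.-1%:R.
Proof.
move=> pp n0 leK; have p1 : 0 < p.-1%:R :> R by rewrite ltr0n; have := prime_gt1 pp; lia.
have A2 : 0 < (2 ^ (n * n))%:R :> R by rewrite ltr0n expn_gt0.
have H1 : p.-1%:R * (n`! * #|dependent_sets R n|)%:R <= (2 ^ (n * n))%:R * K.
  apply: le_trans (_ : p.-1%:R * #|singular_families R n|%:R <= _).
    by rewrite ler_pM2l // ler_nat card_dependent_sets.
  by apply: le_trans (card_singular_families R n pp) _; rewrite ler_pM2l.
rewrite /main_term invf_div mulrA ler_pdivrMr ?exprn_gt0 // mulrAC ler_pdivlMr //.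
apply: le_trans (_ : (2 ^ n * #|dependent_sets R n|)%:R * (n.+1`!)%:R * p.-1%:R <= _).
  by rewrite ler_pM2r // ler_pM2r ?ltr0n ?fact_gt0 // ler_nat card_noncircuits.
rewrite mulnS exprD -natrX -[_ ^+ (n * n)]natrX factS !natrM.
rewrite natrM in H1.
have -> : (2 ^ n)%:R * #|dependent_sets R n|%:R * (n.+1%:R * (n`!)%:R) * p.-1%:R =
  n.+1%:R * (2 ^ n)%:R * (p.-1%:R * ((n`!)%:R * #|dependent_sets R n|%:R)) :> R by ring.
have -> : n.+1%:R * K * ((2 ^ n)%:R * (2 ^ (n * n))%:R) =
  n.+1%:R * (2 ^ n)%:R * ((2 ^ (n * n))%:R * K) by ring.
by rewrite ler_pM2l // -natrM ltr0n muln_gt0 expn_gt0.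
Qed.

(** [K] does not depend on [g], so [g] may be chosen with [2 * K / e <= g]. A prime [p > g * n] then
    brings the bound [(n + 1) * K / (p - 1)] below [e]; that [p <= 10 * g * n] makes the density
    estimate available. *)
Lemma cvg_noncircuits_over_main_term : #|noncircuits R n|%:R / main_term n @[n --> \oo] --> (0 : R).
Proof.
pose K : R := 2 * expR 1 + 3.
have K0 : 0 < K by rewrite /K; have := expR_gt0 (1 : R); lra.
apply/cvgrPdist_le => e e0.
pose g := (Num.truncn (2 * K / e)).+1.
have ge : 2 * K <= e * g%:R.
  rewrite [leRHS]mulrC -ler_pdivrMr //; apply/ltW.
  have x0 : 0 <= 2 * K / e by rewrite divr_ge0 ?mulr_ge0 ?(ltW K0) ?(ltW e0).
  by have /andP[] := truncn_itv x0.
have [N0 hN0] := exists_prime_between.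
have [n1 hn1] := @sum_density_eventually R (10 * g) isT.
exists (N0 + n1).+1 => // n /= nn.
have n0 : (0 < n)%N by apply: leq_trans nn.
have [|p pp /andP[p1 p2]] := hN0 (g * n)%N.
  by apply: leq_trans (leq_trans _ nn) _; rewrite ?leq_pmull // leqW // leq_addr.
have S1 := hn1 n p _ pp _.
have S := noncircuits_over_main_term pp n0 (S1 _ _).
rewrite sub0r normrN ger0_norm; last by rewrite divr_ge0 // ltW // main_term_gt0.
apply: le_trans (S _ _) _.
- by apply: leq_trans nn; rewrite leqW // leq_addl.
- by rewrite -mulnA p2 (leq_trans _ (ltnW p1)) // leq_pmull.
have pg : g%:R * n%:R <= p.-1%:R :> R by rewrite -natrM ler_nat; move: p1; clear; lia.
have nR : 0 < n%:R :> R by rewrite ltr0n.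
have gR : 0 < g%:R :> R by rewrite ltr0n.
have pR : 0 < p.-1%:R :> R by apply: lt_le_trans pg; rewrite mulr_gt0.
rewrite ler_pdivrMr //; apply: le_trans (_ : 2 * n%:R * K <= _).
  rewrite ler_pM2r // -natr1 mulrDl mul1r lerD2l ler1n //.
apply: le_trans (_ : e * (g%:R * n%:R) <= _); last by rewrite ler_pM2l.
by rewrite mulrAC mulrA ler_pM2r.
Qed.

(** Circuits with at most [n] elements number at most [(n + 1) * 'C(2 ^ n - 1, n)], the last
    binomial dominating the smaller ones. This needs [2 * n < 2 ^ n - 1], hence [n > 2]. *)
Lemma kappa_over_main_term_le n : (2 < n)%N ->
  (kappa R n)%:R / main_term n <= (kappa_size R n n.+1)%:R / main_term n + (n.+1 ^ 2)%:R / (2 ^ n)%:R.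
Proof.
move=> n2; have small : (n.*2 < 2 ^ n - 1)%N.
  elim: n n2 => // n IH; rewrite ltnS leq_eqVlt => /orP[/eqP <- //|/IH].
  by rewrite expnS; clear; lia.
have H := leq_trans (kappa_le R n) (leq_add (leqnn _) (sum_bin_le small)).
apply: le_trans (_ : (kappa_size R n n.+1 + n.+1 * 'C(2 ^ n - 1, n))%:R / main_term n <= _).
  by rewrite ler_pM2r ?invr_gt0 ?main_term_gt0 // ler_nat.
rewrite natrD mulrDl lerD2l /main_term invf_div mulrA ler_pdivrMr ?exprn_gt0 //.
rewrite mulrAC ler_pdivlMr ?ltr0n ?expn_gt0 // -!natrX -!natrM ler_nat.
rewrite factS mulnS expnD [(2 ^ n * _)%N]mulnC !mulnA leq_mul2r; apply/orP; right.
rewrite (_ : n.+1 * _ * _ * _ = n.+1 ^ 2 * ('C(2 ^ n - 1, n) * n`!))%N.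
  rewrite bin_ffact leq_mul2l expnM (leq_trans (ffact_le_exp _ _)) ?orbT //.
  by case: (n) => // m; rewrite leq_exp2r // leq_subr.
by rewrite expnS expn1 mulnACA mulnA.
Qed.

Lemma cvg_kappa_size_over_main_term : (kappa_size R n n.+1)%:R / main_term n @[n --> \oo] --> (1 : R).
Proof.
have -> : (fun n => (kappa_size R n n.+1)%:R / main_term n) =
    (fun n => ('C(2 ^ n - 1, n.+1))%:R / main_term n - #|noncircuits R n|%:R / main_term n).
  by apply/funext => n; rewrite -mulrBl -(kappa_size_noncircuits R n) natrD addrK.
rewrite -[X in _ --> X]subr0.
by apply: cvgB; [exact: cvg_bin_over_main_term | exact: cvg_noncircuits_over_main_term].
Qed.

Lemma cvg_kappa_over_main_term : (kappa R n)%:R / main_term n @[n --> \oo] --> (1 : R).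
Proof.
apply: (@squeeze_cvgr _ _ _ _ (fun n : nat => (kappa_size R n n.+1)%:R / main_term n)
  (fun n : nat => (kappa_size R n n.+1)%:R / main_term n + (n.+1 ^ 2)%:R / (2 ^ n)%:R));
  last 2 first.
- exact: cvg_kappa_size_over_main_term.
- rewrite -[X in _ --> X]addr0.
  by apply: cvgD; [exact: cvg_kappa_size_over_main_term | exact: cvg_squares_over_exp2].
exists 3%N => // n /= n3; rewrite kappa_over_main_term_le // andbT.
by rewrite ler_pM2r ?invr_gt0 ?main_term_gt0 // ler_nat kappa_size_le.
Qed.

End Limits.

Theorem corollaryD1 (R : realType) :
  [/\ asymp_equiv (fun n : nat => (kappa R n)%:R : R)
                  (fun n : nat => (kappa_size R n n.+1)%:R : R),
      asymp_equiv (fun n : nat => (kappa_size R n n.+1)%:R : R)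
                  (fun n : nat => 2%:R ^+ (n * n.+1)%N / (n.+1`!)%:R : R),
      asymp_equiv (fun n : nat => 2%:R ^+ (n * n.+1)%N / (n.+1`!)%:R : R)
                  (fun n : nat => ('C((2 ^ n - 1)%N, n.+1))%:R : R)
    & ((fun n : nat => unif_prob R (subcollections n n.+1) (@circuit R n))
         @ \oo --> (1 : R))%classic ].
Proof.
have ks := @cvg_kappa_size_over_main_term R.
have Ydiv (a b : nat -> R) : (fun n => a n / main_term R n / (b n / main_term R n)) = (fun n => a n / b n).
  by apply/funext => n; rewrite [(b n / _)^-1]invf_div mulrA divfK // gt_eqF // main_term_gt0.
have YY : (main_term R n / main_term R n @[n --> \oo] --> (1 : R))%classic.
  have -> : (fun n => main_term R n / main_term R n) = (fun=> 1).
    by apply/funext => n; rewrite divff // gt_eqF // main_term_gt0.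
  exact: cvg_cst.
split.
- rewrite /asymp_equiv -Ydiv; apply: cvg_ratio1 => //.
  exact: cvg_kappa_over_main_term.
- exact: ks.
- rewrite /asymp_equiv -(Ydiv (main_term R)); apply: cvg_ratio1 => //; exact: cvg_bin_over_main_term.
- have -> : (fun n => unif_prob R (subcollections n n.+1) (@circuit R n)) =
     (fun n => (kappa_size R n n.+1)%:R / ('C((2 ^ n - 1)%N, n.+1))%:R).
    apply/funext => n; rewrite /unif_prob card_subcollections; congr (_%:R / _).
    apply: eq_card => C; rewrite !inE andbC; case: (circuitP R C) => [[CN _ _]|] //.
    by rewrite CN.
  rewrite -Ydiv; apply: cvg_ratio1 => //; exact: cvg_bin_over_main_term.
Qed.
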